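(* Let $\mathbb P$ be a probability measure on $\Omega_+$ under which $(\omega(x))_{x\ge0}$ is i.i.d., such that $\mathbb P$-a.s. $\omega(0,i)=1/2$ for all $i\ge3$, and $\mathbb P[\omega(0,2)=1/2]<1$. Then \[P_0[X_n>0\text{ for all } n>0]=\frac{\mathbb E[\omega(0,1)]\,(\mathbb E[\delta^0]-1)_+}{\mathbb E[(2\omega(0,2)-1)\,\omega(0,1)]}.\]
   Context: Cookie environments: $\Omega_+=([1/2,1]^{\mathbb N})^{\mathbb Z}$, $\omega(x)=(\omega(x,i))_{i\ge1}$. $P_{x,\omega}$ is the law of the nearest-neighbor process $(X_n)_{n\ge0}$ with $X_0=x$ which, on its $i$-th visit to site $z$, jumps to $z+1$ with probability $\omega(z,i)$ and to $z-1$ otherwise. Annealed measure $P_x[\cdot]=\mathbb E[P_{x,\omega}[\cdot]]$. $\delta^0(\omega)=\sum_{i\ge1}(2\omega(0,i)-1)$; $a_+=\max\{a,0\}$. *)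

(* Defs.v *)
From HB Require Import structures.
From mathcomp Require Import all_boot all_order all_algebra.
From mathcomp Require Import all_classical all_reals all_analysis.
Set Implicit Arguments. Unset Strict Implicit. Unset Printing Implicit Defensive.
Import Order.TTheory GRing.Theory Num.Theory numFieldNormedType.Exports.
Local Open Scope ring_scope.

Section Cookie.
Variable R : realType.

(* An environment: w x i = omega(x,i), the probability to jump right on the
   i-th visit (i >= 1) to site x. *)
Definition env := int -> nat -> R.

(* Quenched weight of following the steps [steps] (true = +1, false = -1)
   from the current site [cur], given the list [past] of previously visited
   positions (times 0..n-1).  On its j-th visit to z (j = number of occurrences
   of z in past ++ [cur]) the walk jumps to z+1 with prob. w z j. *)
Fixpoint step_weight (w : env) (past : seq int) (cur : int) (steps : seq bool)
  : R :=
  match steps with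
  | [::] => 1
  | b :: s =>
      let p := w cur (count_mem cur past).+1 in
      (if b then p else 1 - p) *
      step_weight w (cur :: past) (if b then cur + 1 else cur - 1) s
  end.

Fixpoint stays_positive (cur : int) (steps : seq bool) : bool :=
  match steps with
  | [::] => true
  | b :: s => let y := if b then cur + 1 else cur - 1 in
              (0 < y) && stays_positive y s
  end.

Definition quenched_pos (w : env) (N : nat) : R :=
  \sum_(s : N.-tuple bool | stays_positive 0 s) step_weight w [::] 0 s.

(* P_{0,w}[X_n > 0 for all n > 0], by continuity from above of the path
   measure along the decreasing events {X_n > 0, 0 < n <= N}. *)
Definition quenched_pos_forever (w : env) : R := limn (quenched_pos w).

(* delta^0(w) = sum_{i >= 1} (2 w(0,i) - 1), as an extended real
   (all terms are >= 0 on Omega_+). *)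
Definition delta0 (w : env) : \bar R :=
  (\sum_(1 <= i <oo) ((2 * w 0%R i - 1)%:E))%E.

End Cookie.

(* Main.v *)
Require Import Defs.
From HB Require Import structures.
From mathcomp Require Import all_boot all_order all_algebra.
From mathcomp Require Import all_classical all_reals all_analysis.
From mathcomp Require Import measurable_realfun ring lra zify.
Import Order.TTheory GRing.Theory Num.Theory numFieldNormedType.Exports.
Local Open Scope classical_set_scope.
Local Open Scope ring_scope.
Set Implicit Arguments. Unset Strict Implicit. Unset Printing Implicit Defensive.

(** Only the cookies on the positive half-line matter: after a first step to
    the right, the walk survives iff it never hits 0 from 1.  Let [r n] be the
    annealed probability that the walk started at 1 hits [n] before 0.  In a fixed
    environment, optional stopping at the exit from the interval (0, n) gives
    [n * P(hit n before 0) = 1 + expected drift consumed].  Site [y] delivers its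
    first cookie iff it is reached, and the second one iff it is moreover
    revisited; a visit that steps right is not followed by a return iff, in the
    fresh environment beyond [y], the walk reaches [n] before [y].  Averaging over
    the environment, with a = E[delta^0] and b = E[(2 omega(0,2) - 1) omega(0,1)],
      [n * r n = 1 + \sum_(y < n) (a * r y - b * r y * r (n - y)) - err n],
    where 0 <= err n <= 1, because a visit to [y] that steps left and never
    returns is charged to [r y - r (y + 1)].  Dividing by [n], the limit q of the
    nonincreasing sequence [r] satisfies q = a q - b q^2; and if q = 0 then a <= 1,
    since [n * r n <= \sum_(y < n) r y + r n] while the quadratic term is negligible
    compared with [\sum_(y < n) r y >= 1]. *)

(** * The stopped walk in a fixed environment and its maximum principle *)

Section Quenched.
Context {R : realType}.
Local Notation cookies := (nat -> nat -> R).
Implicit Types (e : cookies) (x y n N : nat) (g : cookies -> R).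

(* The state of the walk is the pair of its position (a nat, since it is stopped
   at 0) and of the current environment, from which [eat x] removes the cookie
   used at [x].  Visits are counted from 1. *)
Definition eat x e : cookies := fun z i => if z == x then e z i.+1 else e z i.

Definition step (F : cookies -> nat -> R) e x : R :=
  e x 1%N * F (eat x e) x.+1 + (1 - e x 1%N) * F (eat x e) x.-1.

(* [g] is a payoff, evaluated at the environment left when the walk reaches [n];
   [N] is the time horizon. *)
Fixpoint hitN g n N e x : R :=
  match N with
  | 0 => 0
  | N'.+1 => if x == 0%N then 0 else if (n <= x)%N then g e
             else step (hitN g n N') e x
  end.

Definition hit g n e x : R := limn (fun N => hitN g n N e x).

Definition excited e := forall x i, (0 < i)%N -> 2^-1 <= e x i <= 1.

Lemma excited_eat x e : excited e -> excited (eat x e).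
Proof. by move=> ve z i i0; rewrite /eat; case: eqP => _; apply: ve. Qed.

Lemma excited_ge0 e x : excited e -> 0 <= e x 1%N /\ 0 <= 1 - e x 1%N.
Proof. by move=> /(_ x 1%N erefl); lra. Qed.

Lemma ler_step F G e x : excited e ->
  F (eat x e) x.+1 <= G (eat x e) x.+1 ->
  F (eat x e) x.-1 <= G (eat x e) x.-1 ->
  step F e x <= step G e x.
Proof.
by move=> /(excited_ge0 x)[p0 q0] H1 H2; rewrite /step lerD // ler_wpM2l.
Qed.

Lemma step_cst c e x : step (fun _ _ => c) e x = c.
Proof. by rewrite /step; ring. Qed.

Lemma hitN0 g n N e : hitN g n N e 0 = 0.
Proof. by case: N. Qed.

Definition unit_valued g := forall e, excited e -> 0 <= g e <= 1.

Lemma unit_valued1 : unit_valued (fun=> 1).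
Proof. by move=> e _; rewrite ler01 lexx. Qed.

Lemma hitN_range g n N e x : unit_valued g -> excited e ->
  0 <= hitN g n N e x <= 1.
Proof.
move=> ug; elim: N e x => [|N IH] e x ve /=; first by rewrite lexx ler01.
case: eqP => _; first by rewrite lexx ler01.
case: leqP => _; first exact: ug.
have ve' := excited_eat x ve.
rewrite -{1}(step_cst 0 e x) -(step_cst 1 e x).
by apply/andP; split; apply: ler_step => //;
  have /andP[] := IH (eat x e) x.+1 ve'; have /andP[] := IH (eat x e) x.-1 ve'.
Qed.

(** When the horizon expires the payoff is 0, the least value allowed, so a longer horizon can only
    help. This monotonicity is what makes the limit [hit] exist. *)
Lemma hitN_leS g n N e x : unit_valued g -> excited e ->
  hitN g n N e x <= hitN g n N.+1 e x.
Proof.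
move=> ug; elim: N e x => [|N IH] e x ve.
  by have /andP[] := hitN_range n 1 x ug ve.
rewrite [X in X <= _]/= [X in _ <= X]/=.
case: eqP => // _; case: leqP => // _.
by apply: ler_step => //; exact: (IH _ _ (excited_eat x ve)).
Qed.

Lemma hitN_nondecreasing g n e x : unit_valued g -> excited e ->
  nondecreasing_seq (fun N => hitN g n N e x).
Proof. by move=> ug ve; apply/nondecreasing_seqP => N; exact: hitN_leS. Qed.

Lemma hitN_cvg g n e x : unit_valued g -> excited e ->
  hitN g n N e x @[N --> \oo] --> hit g n e x.
Proof.
move=> ug ve; apply: nondecreasing_is_cvgn; first exact: hitN_nondecreasing.
by exists 1 => _ [N _ <-]; have /andP[] := hitN_range n N x ug ve.
Qed.

Lemma hit_range g n e x : unit_valued g -> excited e -> 0 <= hit g n e x <= 1.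
Proof.
move=> ug ve; have c := hitN_cvg (n := n) (x := x) ug ve.
have cv : cvgn (fun N => hitN g n N e x) by apply/cvg_ex; eexists; exact: c.
apply/andP; split.
  by apply: limr_ge => //; near=> N; have /andP[] := hitN_range n N x ug ve.
by apply: limr_le => //; near=> N; have /andP[] := hitN_range n N x ug ve.
Unshelve. all: by end_near. Qed.

Lemma hit0 g n e : hit g n e 0 = 0.
Proof.
rewrite /hit; under [X in limn X]funext do rewrite hitN0.
exact: lim_cst.
Qed.

Lemma hitS_cvg g n e x : unit_valued g -> excited e ->
  hitN g n N.+1 e x @[N --> \oo] --> hit g n e x.
Proof. move=> ug ve; rewrite (cvg_shiftS (fun N => hitN g n N e x)); exact: hitN_cvg. Qed.

Lemma hit_end g n e x : unit_valued g -> excited e ->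
  (0 < x)%N -> (n <= x)%N -> hit g n e x = g e.
Proof.
(* The shifted sequence is used because horizon 0 pays 0 even beyond [n]. *)
move=> ug ve x0 nx; have := hitS_cvg (n := n) (x := x) ug ve.
rewrite /= nx gtn_eqF // => /cvg_lim <- //; exact: lim_cst.
Qed.

Lemma hit_step g n e x : unit_valued g -> excited e ->
  (0 < x < n)%N -> hit g n e x = step (hit g n) e x.
Proof.
move=> ug ve /andP[x0 xn]; have := hitS_cvg (n := n) (x := x) ug ve.
rewrite /= leqNgt xn gtn_eqF //= => /cvg_lim <- //.
have ve' := excited_eat x ve.
apply/cvg_lim => //; apply: cvgD; apply: cvgMr; exact: hitN_cvg.
Qed.

(* As every step goes right with probability at least 1/2, from anywhere the walk
   exits through [n] within [n] steps with probability at least 2^-n; hence any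
   nonnegative upper bound for [F] can be multiplied by 1 - 2^-n. *)
Lemma max_principle (I : cookies -> nat -> Prop) n (F : cookies -> nat -> R) M :
  (forall e x, I e x -> excited e) ->
  (forall e x, I e x -> (0 < x < n)%N -> I (eat x e) x.+1 /\ I (eat x e) x.-1) ->
  (forall e x, I e x -> (x <= n)%N -> F e x <= M) ->
  (forall e x, I e x -> (0 < x < n)%N -> F e x <= step F e x) ->
  (forall e, I e 0%N -> F e 0%N <= 0) -> (forall e, I e n -> F e n <= 0) ->
  forall e x, I e x -> (x <= n)%N -> F e x <= 0.
Proof.
move=> Iv Ic FM Fsub F0 Fn.
pose c : R := 1 - 2^-1 ^+ n.
have h2 : 0 <= 2^-1 ^+ n :> R by rewrite exprn_ge0 // invr_ge0.
have h21 j : 2^-1 ^+ j <= 1 :> R by rewrite exprn_ile1 ?invr_ge0 ?invf_le1 ?ler1n.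
have contr K : 0 <= K -> (forall e x, I e x -> (x <= n)%N -> F e x <= K) ->
    forall e x, I e x -> (x <= n)%N -> F e x <= K * c.
  move=> K0 FK.
  (* Induction on the distance [j] to [n]: a run of [j] steps to the right has probability at least
     2^-j. *)
  have H j : forall e x, I e x -> (x + j)%N = n -> F e x <= K * (1 - 2^-1 ^+ j).
    elim: j => [|j IH] e x Ix xn.
      by rewrite addn0 in xn; subst x; rewrite expr0 subrr mulr0; exact: Fn.
    have [x0|x0] := posnP x.
      by subst x; apply: (le_trans (F0 _ Ix)); rewrite mulr_ge0 // subr_ge0.
    have xin : (0 < x < n)%N by lia.
    apply: (le_trans (Fsub _ _ Ix xin)); have [I1 I2] := Ic _ _ Ix xin.
    have H1 : F (eat x e) x.+1 <= K * (1 - 2^-1 ^+ j) by apply: IH => //; lia.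
    have H2 : F (eat x e) x.-1 <= K by apply: FK => //; lia.
    have /andP[p1 p2] : 2^-1 <= e x 1%N <= 1 by exact: (Iv _ _ Ix).
    rewrite /step exprS.
    set u := 2^-1 ^+ j in H1 *.
    have u0 : 0 <= u by rewrite exprn_ge0 // invr_ge0.
    have H3 : e x 1%N * F (eat x e) x.+1 <= e x 1%N * (K * (1 - u)).
      by rewrite ler_wpM2l //; lra.
    have H4 : (1 - e x 1%N) * F (eat x e) x.-1 <= (1 - e x 1%N) * K.
      by rewrite ler_wpM2l //; lra.
    (* The step right has weight at least 1/2, so the mixture of [K * (1 - u)] and [K] is at most
       [K * (1 - u / 2)]. *)
    have H5 : 0 <= (e x 1%N - 2^-1) * (K * u) by rewrite !mulr_ge0 // subr_ge0.
    nra.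
  move=> e x Ix xn; have := H (n - x)%N e x Ix (subnKC xn) => /le_trans; apply.
  rewrite ler_wpM2l // lerD2l lerN2.
  by rewrite ler_wiXn2l ?invr_ge0 ?invf_le1 ?ler1n ?leq_subr.
(* The contraction applies to nonnegative bounds only, and [M] may be negative. *)
pose M' := Num.max M 0.
have iter k e x : I e x -> (x <= n)%N -> F e x <= M' * c ^+ k.
  elim: k e x => [|k IH] e x Ix xn.
    by rewrite expr0 mulr1; apply: le_trans (FM _ _ Ix xn) _; rewrite le_max lexx.
  rewrite exprSr mulrA; apply: contr Ix xn => //.
  by rewrite mulr_ge0 ?exprn_ge0 ?subr_ge0 // le_max lexx orbT.
move=> e x Ix xn.
have cv : M' * c ^+ k @[k --> \oo] --> (0 : R).
  rewrite -[X in _ --> X](mulr0 M'); apply: cvgMr; apply: cvg_expr.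
  by rewrite ger0_norm ?subr_ge0 // gtrBl exprn_gt0 // invr_gt0.
rewrite -(cvg_lim _ cv) //; apply: limr_ge; first by apply/cvg_ex; eexists; exact: cv.
by near=> k; exact: iter.
Unshelve. all: by end_near. Qed.

Lemma stepB F G e x : 
  step (fun e x => F e x - G e x) e x = step F e x - step G e x.
Proof. by rewrite /step; ring. Qed.

(** The maximum principle is applied to [F] and to [- F]. The invariant [I] restricts the hypotheses
    to the pairs of environment and position that the walk can produce. *)
Lemma harmonic_unique (I : cookies -> nat -> Prop) n (F : cookies -> nat -> R) M :
  (forall e x, I e x -> excited e) ->
  (forall e x, I e x -> (0 < x < n)%N -> I (eat x e) x.+1 /\ I (eat x e) x.-1) ->
  (forall e x, I e x -> (x <= n)%N -> `|F e x| <= M) ->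
  (forall e x, I e x -> (0 < x < n)%N -> F e x = step F e x) ->
  (forall e, I e 0%N -> F e 0%N = 0) -> (forall e, I e n -> F e n = 0) ->
  forall e x, I e x -> (x <= n)%N -> F e x = 0.
Proof.
move=> Iv Ic FM Fs F0 Fn e x Ix xn; apply/eqP; rewrite eq_le; apply/andP; split.
  apply: (max_principle (I := I) (n := n) (M := M)) Ix xn => //.
  - by move=> e' x' I' x'n; apply: le_trans (FM _ _ I' x'n); exact: ler_norm.
  - by move=> e' x' I' x'n; rewrite [X in X <= _]Fs.
  - by move=> e' I'; rewrite F0.
  - by move=> e' I'; rewrite Fn.
rewrite -oppr_le0.
apply: (max_principle (I := I) (n := n) (M := M) (F := fun e x => - F e x)) Ix xn => //.
- by move=> e' x' I' x'n; apply: le_trans (FM _ _ I' x'n); rewrite -normrN ler_norm.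
- by move=> e' x' I' x'n; rewrite [X in - X <= _]Fs // /step !mulrN -opprD.
- by move=> e' I'; rewrite F0 // oppr0.
- by move=> e' I'; rewrite Fn // oppr0.
Qed.

(** * Probabilities of hitting a barrier before 0 *)

Definition reach : nat -> cookies -> nat -> R := hit (fun=> 1).

(** The walk stops at 0 and from [n] on, and the payoff is constant, so no other cookie is ever
    read. *)
Lemma hitN_local n N e e' x : (forall z, (0 < z < n)%N -> e z =1 e' z) ->
  hitN (fun=> 1) n N e x = hitN (fun=> 1) n N e' x.
Proof.
elim: N e e' x => [|N IH] e e' x ee' //=.
case: posnP => // x0; case: leqP => // xn.
have H z : (0 < z < n)%N -> eat x e z =1 eat x e' z.
  by move=> zn i; rewrite /eat; case: eqP => _; apply: ee'.
by rewrite /step (IH _ _ x.+1 H) (IH _ _ x.-1 H) ee' // x0.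
Qed.

Lemma reach_local n e e' x : (forall z, (0 < z < n)%N -> e z =1 e' z) ->
  reach n e x = reach n e' x.
Proof.
move=> ee'; rewrite /reach /hit.
by under [X in limn X = _]funext do rewrite (hitN_local _ _ ee').
Qed.

Lemma reach_eat n e x z : (z == 0)%N || (n <= z)%N ->
  reach n (eat z e) x = reach n e x.
Proof.
move=> zn; apply: reach_local => z' z'n i; rewrite /eat; case: eqP => // zz'.
by lia.
Qed.

Lemma reach0 n e : reach n e 0 = 0. Proof. exact: hit0. Qed.

Lemma reach_range n e x : excited e -> 0 <= reach n e x <= 1.
Proof. by move=> ve; apply: hit_range => //; exact: unit_valued1. Qed.

Lemma reach_end n e x : excited e -> (0 < x)%N -> (n <= x)%N -> reach n e x = 1.
Proof. by move=> ve x0 nx; rewrite /reach hit_end //; exact: unit_valued1. Qed.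

Lemma reach_step n e x : excited e -> (0 < x < n)%N ->
  reach n e x = step (reach n) e x.
Proof. by move=> ve xn; apply: hit_step => //; exact: unit_valued1. Qed.

(** A walk cannot get to the farther barrier without passing the nearer one; analytically, the
    difference is harmonic inside and nonpositive at both ends. *)
Lemma reach_leS n e x : (0 < n)%N -> excited e -> (x <= n)%N ->
  reach n.+1 e x <= reach n e x.
Proof.
move=> n0 ve xn; rewrite -subr_le0.
apply: (max_principle (I := fun e _ => excited e) (n := n) (M := 1)
  (F := fun e x => reach n.+1 e x - reach n e x)) ve xn => //.
- by move=> e' x' v' _; split; exact: excited_eat.
- move=> e' x' v' _; have := reach_range n.+1 x' v'.
  by have := reach_range n x' v'; lra.
- move=> e' x' v' /andP[x0 xn]; rewrite stepB (@reach_step n.+1) ?x0 ?ltnS ?(ltnW xn) //.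
  by rewrite -(@reach_step n) ?x0.
- by move=> e' _; rewrite !reach0 subrr.
- move=> e' v'; rewrite (@reach_end n) //.
  by have := reach_range n.+1 n v'; lra.
Qed.

(* Probability of visiting [y] before [0] and then, started anew from [y - 1],
   visiting [y] before [0] again. *)
Definition reach2 y : cookies -> nat -> R := hit (fun e => reach y e y.-1) y.

Lemma unit_valued_reach y x : unit_valued (fun e => reach y e x).
Proof. by move=> e ve; exact: reach_range. Qed.

Lemma reach20 n e : reach2 n e 0 = 0. Proof. exact: hit0. Qed.

Lemma reach2_range n e x : excited e -> 0 <= reach2 n e x <= 1.
Proof. by move=> ve; apply: hit_range => //; exact: unit_valued_reach. Qed.

Lemma reach2_end n e : excited e -> (0 < n)%N -> reach2 n e n = reach n e n.-1.
Proof. by move=> ve x0; rewrite /reach2 hit_end //; exact: unit_valued_reach. Qed.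

Lemma reach2_step n e x : excited e -> (0 < x < n)%N ->
  reach2 n e x = step (reach2 n) e x.
Proof. by move=> ve xn; apply: hit_step => //; exact: unit_valued_reach. Qed.

Lemma reach2_le n e x : (0 < n)%N -> excited e -> (x <= n)%N ->
  reach2 n e x <= reach n e x.
Proof.
move=> n0 ve xn; rewrite -subr_le0.
apply: (max_principle (I := fun e _ => excited e) (n := n) (M := 1)
  (F := fun e x => reach2 n e x - reach n e x)) ve xn => //.
- by move=> e' x' v' _; split; exact: excited_eat.
- move=> e' x' v' _; have := reach_range n x' v'.
  by have := reach2_range n x' v'; lra.
- by move=> e' x' v' xn'; rewrite stepB -reach_step // -reach2_step.
- by move=> e' _; rewrite reach20 reach0 subrr.
- move=> e' v'; rewrite reach_end //.
  by have := reach2_range n n v'; lra.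
Qed.

Lemma eat_neq x y e : x != y -> eat x e y = e y.
Proof. by move=> xy; apply/funext => i; rewrite /eat eq_sym (negbTE xy). Qed.

(* After reaching [y], the walk visits [y + 1] before [0] only if it steps right
   or else returns to [y] from [y - 1]. *)
Lemma reachS_le y e x : (0 < y)%N -> excited e -> (x <= y)%N ->
  reach y.+1 e x <= e y 1%N * reach y e x + (1 - e y 1%N) * reach2 y e x.
Proof.
move=> y0 ve xy; rewrite -subr_le0.
apply: (max_principle (I := fun e _ => excited e) (n := y) (M := 1)
  (F := fun e x => reach y.+1 e x -
    (e y 1%N * reach y e x + (1 - e y 1%N) * reach2 y e x)))
  ve xy => //.
- by move=> e' x' v' _; split; exact: excited_eat.
- move=> e' x' v' _; have := reach_range y.+1 x' v'.
  have /andP[a _] := reach_range y x' v'; have /andP[b _] := reach2_range y x' v'.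
  have [p0 q0] := excited_ge0 y v'.
  by have := mulr_ge0 p0 a; have := mulr_ge0 q0 b; lra.
- move=> e' x' v' xn'; rewrite (@reach_step y.+1) //; last by lia.
  rewrite (@reach_step y) // reach2_step // /step !eat_neq; [|by lia..].
  by rewrite le_eqVlt; apply/orP; left; apply/eqP; ring.
- by move=> e' _; rewrite !reach0 reach20; lra.
- move=> e' v'; rewrite (@reach_step y.+1) ?y0 ?ltnSn // (@reach_end y) // reach2_end // /step.
  rewrite reach_end //; last exact: excited_eat.
  have [p0 q0] := excited_ge0 y v'.
  have := reach_leS y0 (excited_eat y v') (leq_pred y).
  rewrite (@reach_eat y) ?leqnn ?orbT // => H.
  by have := ler_wpM2l q0 H; lra.
Qed.

(** * Expected drift consumed at each site, and optional stopping *)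

Definition translate y e : cookies := fun z => e (y + z)%N.

Lemma excited_translate y e : excited e -> excited (translate y e).
Proof. by move=> ve z i; exact: ve. Qed.

Lemma translate_eat_lt x y e : (x < y)%N -> translate y (eat x e) = translate y e.
Proof. by move=> xy; apply/funext => z; rewrite /translate eat_neq //; lia. Qed.

Lemma translate_eat x y e : (y <= x)%N ->
  translate y (eat x e) = eat (x - y)%N (translate y e).
Proof.
move=> xy; apply/funext => z; apply/funext => i; rewrite /translate /eat.
by have -> : (y + z == x)%N = (z == x - y)%N by lia.
Qed.

(* Expected drift consumed at [y] before leaving the interval between [0] and
   [n], when [y] holds at most two cookies, and at most one if [y < x]. *)
Definition drift y n e x : R :=
  if (x <= y)%N then
    reach y e x * ((2 * e y 1%N - 1) +
      e y 1%N * (2 * e y 2%N - 1) * (1 - reach (n - y) (translate y e) 1)) +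
    (1 - e y 1%N) * (2 * e y 2%N - 1) * reach2 y e x
  else (2 * e y 1%N - 1) * (1 - reach (n - y) (translate y e) (x - y)).

Definition two_cookies n e :=
  forall z i, (0 < z < n)%N -> (2 < i)%N -> e z i = 2^-1.

(** Invariant under which [drift] is correct: a site to the left of the walk has been visited, so at
    most one of its two cookies is left. It holds vacuously at the starting point 1. *)
Definition explored n e x :=
  [/\ excited e, two_cookies n e
    & forall z, (0 < z < n)%N -> (z < x)%N -> e z 2%N = 2^-1].

Lemma explored_eat n e x : (0 < x < n)%N -> explored n e x ->
  explored n (eat x e) x.+1 /\ explored n (eat x e) x.-1.
Proof.
move=> xn [ve te pe].
have te' : two_cookies n (eat x e).
  by move=> z i zn i2; rewrite /eat; case: eqP => _; apply: te => //; lia.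
have ve' := excited_eat x ve.
split; split => // z zn zx; rewrite /eat; case: eqP => xz; try exact: te.
- by apply: pe => //; lia.
- by apply: pe => //; lia.
Qed.

(** A crude bound suffices, since [harmonic_unique] only asks for some bound; 3 counts one for each
    of the three products in the first branch. *)
Lemma drift_range y n e x : excited e -> 0 <= drift y n e x <= 3.
Proof.
move=> ve; rewrite /drift; set r := reach y e x; set s := reach2 y e x.
have vt := excited_translate y ve.
have /andP[r0 r1] : 0 <= r <= 1 by exact: reach_range.
have /andP[s0 s1] : 0 <= s <= 1 by exact: reach2_range.
have /andP[p0 p1] : 2^-1 <= e y 1%N <= 1 by exact: ve.
have /andP[q0 q1] : 2^-1 <= e y 2%N <= 1 by exact: ve.
have prod01 (a b : R) : 0 <= a <= 1 -> 0 <= b <= 1 -> 0 <= a * b <= 1.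
  by move=> /andP[? ?] /andP[? ?]; rewrite mulr_ge0 // mulr_ile1.
have c1 : 0 <= 2 * e y 1%N - 1 <= 1 by lra.
have c2 : 0 <= 2 * e y 2%N - 1 <= 1 by lra.
have p : 0 <= e y 1%N <= 1 by lra.
have q : 0 <= 1 - e y 1%N <= 1 by lra.
case: ifP => _.
  have h := reach_range (n - y) 1 vt.
  have h' : 0 <= 1 - reach (n - y) (translate y e) 1 <= 1 by lra.
  have rr : 0 <= r <= 1 by lra.
  have ss : 0 <= s <= 1 by lra.
  have H1 := prod01 _ _ rr c1.
  have H2 := prod01 _ _ rr (prod01 _ _ (prod01 _ _ p c2) h').
  have H3 := prod01 _ _ (prod01 _ _ q c2) ss.
  by rewrite mulrDr; lra.
have h := reach_range (n - y) (x - y) vt.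
have h' : 0 <= 1 - reach (n - y) (translate y e) (x - y) <= 1 by lra.
by have := prod01 _ _ c1 h'; lra.
Qed.

(** The expected future drift at [y] is conserved by a step, except that a step from [y] itself
    cashes in its current cookie. *)
Lemma drift_step y n e x : explored n e x -> (0 < x < n)%N -> (0 < y < n)%N ->
  drift y n e x = (if x == y then 2 * e x 1%N - 1 else 0) + step (drift y n) e x.
Proof.
move=> [ve te pe] xn yn; have ve' := excited_eat x ve.
have [xy|xy|xy] := ltngtP x y.
(* Left of [y], [drift] is a combination of [reach] and [reach2] whose coefficients are not affected
   by cookies eaten at [x]. *)
- rewrite /step /drift (ltnW xy) xy (leq_trans (leq_pred x) (ltnW xy)).
  rewrite translate_eat_lt // !eat_neq; [|by lia..].
  rewrite (@reach_step y) //; last by lia.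
  by rewrite reach2_step; [|by []|by lia]; rewrite /step; ring.
(* Right of [y], the one remaining cookie is delivered iff the walk returns to [y] before exiting at
   [n]. *)
- rewrite /step /drift leqNgt xy /= leqNgt (ltnW xy : (y < x.+1)%N) /=.
  rewrite translate_eat; last by lia.
  have vt := excited_translate y ve.
  rewrite (reach_step vt); last by lia.
  rewrite !eat_neq; [|by lia..].
  rewrite /step.
  have -> : (x.+1 - y = (x - y).+1)%N by lia.
  have -> : translate y e (x - y)%N 1%N = e x 1%N by rewrite /translate subnKC // ltnW.
  (* If the left step lands on [y], the cookie is delivered for sure, and the neutral second cookie
     makes both branches of [drift] agree there. *)
  case: leqP => H.
    have -> : x.-1 = y by lia.
    have -> : (x - y).-1 = 0%N by lia.
    rewrite reach0 (reach_end ve') //; last by lia.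
    by rewrite (pe y yn xy); field.
  have -> : (x.-1 - y = (x - y).-1)%N by lia.
  by ring.
(* At [y] the first cookie goes and the second becomes the only one, as the third is neutral. It is
   delivered on return from [x.+1] or from [x.-1]. *)
- subst y; rewrite /step /drift leqnn ltnn leq_pred.
  have vt := excited_translate x ve.
  rewrite translate_eat // subnn.
  rewrite !reach_eat ?leqnn ?orbT // reach2_end //; last by lia.
  rewrite (@reach_end x e x) //; last by lia.
  have -> : (x.+1 - x = 1)%N by lia.
  rewrite /eat eqxx (te x 3%N) //.
  by field.
Qed.

(** Optional stopping: position plus expected future drift is a martingale. It agrees with the left
    side at 0 and at [n], where no drift remains, hence everywhere by uniqueness. *)
Lemma drift_sum n e x : (0 < n)%N -> explored n e x -> (x <= n)%N ->
  n%:R * reach n e x = x%:R + \sum_(1 <= y < n) drift y n e x.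
Proof.
move=> n0 ie xn; apply/eqP; rewrite -subr_eq0; apply/eqP.
pose F e x := n%:R * reach n e x - (x%:R + \sum_(1 <= y < n) drift y n e x).
rewrite -/(F e x).
apply: (harmonic_unique (I := explored n) (n := n) 
  (M := n%:R + (n%:R + 3 * n%:R)) (F := F)) ie xn => //.
- by move=> e' x' [].
- by move=> e' x' ie xn; exact: explored_eat.
- move=> e' x' [ve _ _] xn; rewrite /F.
  have /andP[a b] := reach_range n x' ve.
  apply: le_trans (ler_normB _ _) _; apply: lerD.
    rewrite normrM ger0_norm ?ler0n // ger0_norm //.
    by rewrite ler_piMr.
  apply: le_trans (ler_normD _ _) _; apply: lerD.
    by rewrite ger0_norm // ler_nat.
  apply: le_trans (ler_norm_sum _ _ _) _.
  apply: (@le_trans _ _ (\sum_(1 <= y < n) 3)).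
    apply: ler_sum => y _; have /andP[c d] := drift_range y n x' ve.
    by rewrite ger0_norm.
  rewrite sumr_const_nat -[X in X <= _]mulr_natr ler_wpM2l // ler_nat; lia.
- move=> e' x' ie xn; have ve : excited e' by case: ie.
  (* Only the summand at the current site fails to be harmonic; its excess is the mean displacement
     of the step. *)
  have Hs : \sum_(1 <= y < n) drift y n e' x' =
      (2 * e' x' 1%N - 1) + step (fun e x => \sum_(1 <= y < n) drift y n e x) e' x'.
    rewrite (eq_big_nat _ _ (F2 := fun y =>
      (if x' == y then 2 * e' x' 1%N - 1 else 0) + step (drift y n) e' x')); last first.
      by move=> y yn; exact: drift_step.
    rewrite big_split /=; congr (_ + _).
      rewrite (big_rem x') ?mem_index_iota //= eqxx big_seq big1 ?addr0 // => y.
      by rewrite (rem_filter _ (iota_uniq _ _)) mem_filter /= eq_sym => /andP[/negbTE ->].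
    by rewrite /step big_split /= !mulr_sumr.
  rewrite /F Hs (reach_step ve xn) /step.
  have -> : (x'.-1)%:R = x'%:R - 1 :> R.
    by case: x' xn {ie Hs} => // m _; rewrite /= -natr1 addrK.
  by rewrite -natr1; ring.
- move=> e' [ve _ _]; rewrite /F reach0 mulr0 big1_seq ?addr0 ?subr0 ?oppr0 // => y _.
  by rewrite /drift reach0 reach20 mul0r mulr0 addr0.
- move=> e' [ve _ _]; rewrite /F reach_end // big_nat big1 ?addr0 ?mulr1 ?subrr // => y yn.
  rewrite /drift leqNgt; have -> /= : (y < n)%N by lia.
  rewrite reach_end ?subrr ?mulr0 //; first exact: excited_translate.
  by lia.
Qed.

(** Replacing [reach2 y] by [reach y] in the drift leaves products of functionals that read disjoint
    sets of sites, ready for averaging. The price is an error sum that telescopes to at most 1. *)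
Lemma reach_bounds n e : (0 < n)%N -> excited e -> two_cookies n e ->
  0 <= n%:R * reach n e 1 - \sum_(1 <= y < n)
    (reach y e 1 * (2 * e y 1%N - 1) + reach y e 1 * (2 * e y 2%N - 1)
    - reach y e 1 * (((2 * e y 2%N - 1) * e y 1%N) *
        reach (n - y) (translate y e) 1)) <= 1.
Proof.
move=> n0 ve te; set D := \sum_(_ <= _ < _) _.
have -> : n%:R * reach n e 1 = 1 + \sum_(1 <= y < n) drift y n e 1.
  by rewrite drift_sum //; split => // z; lia.
have DE : \sum_(1 <= y < n) drift y n e 1 = D - \sum_(1 <= y < n)
    ((2 * e y 2%N - 1) * ((1 - e y 1%N) * (reach y e 1 - reach2 y e 1))).
  rewrite /D -sumrB; apply: eq_big_nat => y /andP[y0 yn].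
  by rewrite /drift y0; ring.
(* This is [reachS_le] rearranged, with the drift of the second cookie bounded by 1. *)
have b y : (0 < y)%N -> 0 <= (2 * e y 2%N - 1) *
    ((1 - e y 1%N) * (reach y e 1 - reach2 y e 1)) <= reach y e 1 - reach y.+1 e 1.
  move=> y0; have H1 := reachS_le y0 ve y0; have H2 := reach2_le y0 ve y0.
  have H3 := ve y 1%N erefl; have H4 := ve y 2%N erefl.
  set u := (1 - e y 1%N) * _.
  have u0 : 0 <= u by rewrite mulr_ge0 // subr_ge0 //; lra.
  have ur : u <= reach y e 1 - reach y.+1 e 1 by rewrite /u; lra.
  have c0 : 0 <= 2 * e y 2%N - 1 by lra.
  rewrite mulr_ge0 //=; apply: le_trans ur.
  by rewrite ler_piMl //; lra.
have E0 : 0 <= \sum_(1 <= y < n)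
    ((2 * e y 2%N - 1) * ((1 - e y 1%N) * (reach y e 1 - reach2 y e 1))).
  by rewrite big_nat sumr_ge0 // => y /andP[y0 _]; have /andP[] := b y y0.
have E1 : \sum_(1 <= y < n)
    ((2 * e y 2%N - 1) * ((1 - e y 1%N) * (reach y e 1 - reach2 y e 1))) <= 1.
  apply: (@le_trans _ _ (\sum_(1 <= y < n) (reach y e 1 - reach y.+1 e 1))).
    rewrite big_nat [X in _ <= X]big_nat ler_sum // => y /andP[y0 _].
    by have /andP[] := b y y0.
  have -> : \sum_(1 <= y < n) (reach y e 1 - reach y.+1 e 1) = reach 1 e 1 - reach n e 1.
    rewrite -[LHS]opprK -sumrN.
    under eq_bigr do rewrite opprB.
    by rewrite telescope_sumr // opprB.
  rewrite reach_end //; have := reach_range n 1 ve; lra.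
by rewrite DE; lra.
Qed.

(** * Survival, as avoidance of 0 over growing horizons *)

Fixpoint stayN N e x : R :=
  if x == 0%N then 0 else
  match N with 0 => 1 | N'.+1 => step (stayN N') e x end.

Lemma stayN0 N e : stayN N e 0 = 0. Proof. by case: N. Qed.

(** A barrier at distance at least [N] takes at least [N] steps to reach, and 0 is avoided
    meanwhile. *)
Lemma reach_le_stayN N n e x : excited e -> (0 < n)%N -> (x + N <= n)%N ->
  reach n e x <= stayN N e x.
Proof.
move=> ve n0; elim: N e x ve => [|N IH] e x ve xN.
  have [->|x0] := posnP x; first by rewrite reach0 stayN0.
  by rewrite /= gtn_eqF //; have /andP[] := reach_range n x ve.
have [->|x0] := posnP x; first by rewrite reach0 stayN0.
rewrite reach_step //; last by lia.
rewrite /= gtn_eqF //.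
by apply: ler_step => //; apply: IH; try exact: excited_eat; lia.
Qed.

Lemma stayN_range N e x : excited e -> 0 <= stayN N e x <= 1.
Proof.
elim: N e x => [|N IH] e x ve /=.
  by case: eqP => _; rewrite ?lexx ?ler01.
case: eqP => _; rewrite ?lexx ?ler01 //.
have ve' := excited_eat x ve.
rewrite -{1}(step_cst 0 e x) -(step_cst 1 e x).
by apply/andP; split; apply: ler_step => //;
  have /andP[] := IH (eat x e) x.+1 ve'; have /andP[] := IH (eat x e) x.-1 ve'.
Qed.

Lemma stayNS N e x :
  stayN N.+1 e x = if x == 0%N then 0 else step (stayN N) e x.
Proof. by []. Qed.

Lemma stayN_geS N e x : excited e -> stayN N.+1 e x <= stayN N e x.
Proof.
elim: N e x => [|N IH] e x ve.
  rewrite [X in _ <= X]/=; case: ifP => x0.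
    by rewrite (eqP x0) stayN0.
  by have /andP[] := stayN_range 1 x ve.
rewrite (stayNS N.+1) (stayNS N); case: eqP => // _.
by apply: ler_step => //; exact: (IH _ _ (excited_eat x ve)).
Qed.

Lemma stayN_cvg e x : excited e -> cvgn (fun N => stayN N e x).
Proof.
move=> ve; apply: nonincreasing_is_cvgn.
  by apply/nonincreasing_seqP => N; exact: stayN_geS.
by exists 0 => _ [N _ <-]; have /andP[] := stayN_range N x ve.
Qed.

Definition stay e x := limn (fun N => stayN N e x).

Lemma stay_range e x : excited e -> 0 <= stay e x <= 1.
Proof.
move=> ve; have c := stayN_cvg (x := x) ve; apply/andP; split.
  by apply: limr_ge => //; near=> N; have /andP[] := stayN_range N x ve.
by apply: limr_le => //; near=> N; have /andP[] := stayN_range N x ve.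
Unshelve. all: by end_near. Qed.

Lemma stay_step e x : excited e -> (0 < x)%N -> stay e x = step stay e x.
Proof.
move=> ve x0; have ve' := excited_eat x ve.
have : stayN N.+1 e x @[N --> \oo] --> stay e x.
  rewrite (cvg_shiftS (fun N => stayN N e x)); exact: stayN_cvg.
rewrite /= gtn_eqF // => /cvg_lim <- //.
by apply/cvg_lim => //; apply: cvgD; apply: cvgMr; exact: stayN_cvg.
Qed.

(** A walk cannot remain between 0 and [n] forever, so survival forces an exit through [n]; the
    maximum principle expresses this without a path space. *)
Lemma stay_le_reach n e x : (0 < n)%N -> excited e -> (x <= n)%N ->
  stay e x <= reach n e x.
Proof.
move=> n0 ve xn; rewrite -subr_le0.
apply: (max_principle (I := fun e _ => excited e) (n := n) (M := 1)
  (F := fun e x => stay e x - reach n e x)) ve xn => //.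
- by move=> e' x' v' _; split; exact: excited_eat.
- move=> e' x' v' _; have := reach_range n x' v'.
  by have := stay_range x' v'; lra.
- move=> e' x' v' xn'; rewrite stepB -reach_step // -stay_step //.
  by case/andP: xn'.
- move=> e' _; rewrite reach0 subr0 /stay.
  under [X in limn X]funext do rewrite stayN0.
  by rewrite lim_cst.
- move=> e' v'; rewrite reach_end //.
  by have := stay_range n v'; lra.
Qed.

Lemma reach_cvg_stay e : excited e -> reach n.+1 e 1 @[n --> \oo] --> stay e 1.
Proof.
move=> ve; apply: (@squeeze_cvgr _ _ _ _ (fun=> stay e 1) (fun n => stayN n e 1)).
- near=> n; rewrite stay_le_reach //= reach_le_stayN //.
- exact: cvg_cst.
- exact: stayN_cvg.
Unshelve. all: by end_near. Qed.

End Quenched.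

(** * From sums over paths to the recursion on environments *)

Section Link.
Context {R : realType}.
Implicit Types (w : env R) (e : nat -> nat -> R) (x n N : nat).

Lemma sum_tuple_cons N (P : pred (seq bool)) (F : seq bool -> R) :
  \sum_(s : N.+1.-tuple bool | P s) F s =
  \sum_(b : bool) \sum_(s : N.-tuple bool | P (b :: s)) F (b :: s).
Proof.
rewrite pair_big_dep /=.
rewrite (reindex (fun q : bool * N.-tuple bool => cons_tuple q.1 q.2)) //=.
exists (fun s : N.+1.-tuple bool => (thead s, behead_tuple s)).
  by move=> [b s] _ /=; congr pair; apply/val_inj.
by move=> s _ /=; apply/val_inj => /=; case/tupleP: s => b s.
Qed.

(** Turns the past of a path into the environment that remains: earlier visits to a site shift its
    cookie index. *)
Definition half_line w (past : seq int) : nat -> nat -> R :=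
  fun z i => w z%:Z (count_mem z%:Z past + i)%N.

Lemma half_line_cons w past x :
  half_line w (x%:Z :: past) = eat x (half_line w past).
Proof.
apply/funext => z; apply/funext => i; rewrite /half_line /eat /= eqz_nat eq_sym.
by case: eqP => [->|_]; rewrite ?add0n // addnS addSn.
Qed.

Lemma sum_step_weight w past N x : (0 < x)%N ->
  \sum_(s : N.-tuple bool | stays_positive x%:Z s) step_weight w past x%:Z s =
  stayN N (half_line w past) x.
Proof.
elim: N past x => [|N IH] past x x0.
  rewrite /= gtn_eqF // (big_pred1 [tuple]) // => s.
  by rewrite (tuple0 s) /= eqxx.
rewrite (sum_tuple_cons N (stays_positive x%:Z) (step_weight w past x%:Z)).
rewrite big_bool stayNS gtn_eqF // /step -half_line_cons.
have -> : half_line w past x 1 = w x%:Z (count_mem x%:Z past).+1.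
  by rewrite /half_line addn1.
have E1 : x%:Z + 1 = x.+1%:Z by lia.
have E2 : x%:Z - 1 = x.-1%:Z by lia.
rewrite /= E1 E2 -IH //; congr (_ + _); first by rewrite mulr_sumr.
(* A left step onto 0 leaves no admissible path, which matches the value 0 of [stayN] there. *)
have [->|x1] := posnP x.-1; first by rewrite stayN0 mulr0 big_pred0.
by rewrite -IH // mulr_sumr; apply: eq_bigl => s; rewrite ltz_nat x1.
Qed.

Lemma quenched_posE w N :
  quenched_pos w N.+1 = w 0 1%N * stayN N (eat 0 (half_line w [::])) 1.
Proof.
rewrite /quenched_pos (sum_tuple_cons N (stays_positive 0) (step_weight w [::] 0)).
rewrite big_bool /= [X in _ + X]big_pred0 // addr0 -half_line_cons.
by rewrite -(sum_step_weight _ _ _ (ltn0Sn 0)) mulr_sumr.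
Qed.

Lemma quenched_pos_foreverE w : excited (half_line w [::]) ->
  quenched_pos_forever w = w 0 1%N * stay (half_line w [::]) 1.
Proof.
move=> ve; have ve' := excited_eat 0 ve.
(* The cookie eaten at 0 is invisible to a walk stopped at 0; locality is available for [reach], so
   the claim passes through the limit. *)
have -> : stay (half_line w [::]) 1 = stay (eat 0 (half_line w [::])) 1.
  rewrite -(cvg_lim _ (reach_cvg_stay ve)) // -(cvg_lim _ (reach_cvg_stay ve')) //.
  by under [X in limn X]funext do rewrite -(@reach_eat _ _ _ _ 0) //.
apply/cvg_lim => //; rewrite -(cvg_shiftS (quenched_pos w)).
rewrite (funext (quenched_posE w)).
by apply: cvgMr; exact: stayN_cvg.
Qed.

End Link.

(** * Uniqueness of laws from a generating family stable under intersection *)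

Section PreimageUnique.
Context d (T : measurableType d) (R : realType) (E : pointedType).
Variables (G : set (set E)) (X X' : T -> E).
Hypotheses (GI : setI_closed G) (GT : G setT).
Hypotheses (mX : forall U, G U -> measurable (X @^-1` U))
           (mX' : forall U, G U -> measurable (X' @^-1` U)).

Local Notation S := (g_sigma_algebraType G).

Lemma measurable_fun_generated (Y : T -> E) :
  (forall U, G U -> measurable (Y @^-1` U)) ->
  measurable_fun setT (Y : T -> S).
Proof.
move=> mY; apply: (@measurability _ _ _ S setT Y G) => // _ [U GU <-].
by rewrite setTI; exact: mY.
Qed.

(** Dynkin uniqueness for image measures. Allowing two maps serves equality in law; allowing two
    measures serves independence. *)
Lemma preimage_measure_unique (Q Q' : {measure set T -> \bar R}) :
  (Q setT < +oo)%E ->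
  (forall U, G U -> Q (X @^-1` U) = Q' (X' @^-1` U)) ->
  forall U, <<s G >> U -> Q (X @^-1` U) = Q' (X' @^-1` U).
Proof.
move=> Qfin QQ' U GU.
have m1 := measurable_fun_generated mX.
have m2 := measurable_fun_generated mX'.
have H := @g_sigma_algebra_measure_unique _ R S G _ (fun=> setT) _ _
 (pushforward Q (X : T -> S)) (pushforward Q' (X' : T -> S)).
apply: H => //.
- by move=> V GV; exact: sub_sigma_algebra.
- exact: bigcup_const.
Qed.

End PreimageUnique.

(** * Independence: product expectations and extension from generators *)

Section Independence.
Context d (T : measurableType d) (R : realType) (P : probability T R).

(** The joint law agrees with the product law on rectangles, hence everywhere, and Tonelli separates
    the integrals. *)
Lemma integralM_indep (F G : T -> R) :
  measurable_fun setT F -> measurable_fun setT G ->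
  (forall t, 0 <= F t) -> (forall t, 0 <= G t) ->
  (forall A B, measurable A -> measurable B ->
    P (F @^-1` A `&` G @^-1` B) = (P (F @^-1` A) * P (G @^-1` B))%E) ->
  (\int[P]_t (F t * G t)%:E = (\int[P]_t (F t)%:E) * (\int[P]_t (G t)%:E))%E.
Proof.
move=> mF mG F0 G0 FG.
pose FX : {RV P >-> R} := HB.pack F (isMeasurableFun.Build _ _ _ _ _ mF).
pose GX : {RV P >-> R} := HB.pack G (isMeasurableFun.Build _ _ _ _ _ mG).
have mFG : measurable_fun setT (fun t => (F t, G t)) by exact: measurable_fun_pair.
(* The absolute value keeps the integrand nonnegative on all of [R] and is the identity on the
   values of [F] and [G]. *)
pose nf : R -> \bar R := fun x => (`|x|)%:E.
have nfun : measurable_fun setT nf.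
  by apply/measurable_EFinP; exact: normr_measurable.
pose h (z : R * R) : \bar R := (nf z.1 * nf z.2)%E.
have mh : measurable_fun setT h.
  by apply: emeasurable_funM; apply: measurableT_comp.
have h0 z : (0 <= h z)%E by rewrite mule_ge0 // lee_fin.
have dF : (\int[distribution P FX]_x nf x = \int[P]_t (F t)%:E)%E.
  rewrite ge0_integral_pushforward //; last by move=> y _; rewrite lee_fin.
  by apply: eq_integral => t _ /=; rewrite /nf ger0_norm.
have dG : (\int[distribution P GX]_x nf x = \int[P]_t (G t)%:E)%E.
  rewrite ge0_integral_pushforward //; last by move=> y _; rewrite lee_fin.
  by apply: eq_integral => t _ /=; rewrite /nf ger0_norm.
transitivity (\int[pushforward P (fun t => (F t, G t))]_z h z)%E.
  rewrite ge0_integral_pushforward //.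
  by apply: eq_integral => t _; rewrite /h /nf /= !ger0_norm // EFinM.
transitivity (\int[(distribution P FX \x distribution P GX)%E]_z h z)%E.
  apply: eq_measure_integral => A mA _; apply/esym.
  exact: product_measure_unique.
rewrite fubini_tonelli1 // /fubini_F.
transitivity (\int[distribution P FX]_x (nf x * \int[P]_t (G t)%:E))%E.
  apply: eq_integral => x _; rewrite -dG /h /=.
  by rewrite ge0_integralZl // ?lee_fin // => y _; rewrite lee_fin.
rewrite ge0_integralZr // ?dF //; first by move=> x _; rewrite lee_fin.
by apply: integral_ge0 => t _; rewrite lee_fin.
Qed.

Lemma eq_integral_law (F G : T -> R) :
  measurable_fun setT F -> measurable_fun setT G ->
  (forall t, 0 <= F t) -> (forall t, 0 <= G t) ->
  (forall A, measurable A -> P (F @^-1` A) = P (G @^-1` A)) ->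
  (\int[P]_t (F t)%:E = \int[P]_t (G t)%:E)%E.
Proof.
move=> mF mG F0 G0 FG.
pose nf : R -> \bar R := fun x => (`|x|)%:E.
have nfun : measurable_fun setT nf.
  by apply/measurable_EFinP; exact: normr_measurable.
transitivity (\int[pushforward P F]_x nf x)%E.
  rewrite ge0_integral_pushforward //; last by move=> y _; rewrite lee_fin.
  by apply: eq_integral => t _ /=; rewrite /nf ger0_norm.
transitivity (\int[pushforward P G]_x nf x)%E.
  by apply: eq_measure_integral => A mA _; exact: FG.
rewrite ge0_integral_pushforward //; last by move=> y _; rewrite lee_fin.
by apply: eq_integral => t _ /=; rewrite /nf ger0_norm.
Qed.

(** One event is fixed at a time: [P] restricted to it and a scalar multiple of [P] agree on
    generators, hence on the generated sigma-algebra. *)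
Lemma preimage_indep (E E' : pointedType) (G : set (set E)) (G' : set (set E'))
    (X : T -> E) (X' : T -> E') :
  setI_closed G -> G setT -> setI_closed G' -> G' setT ->
  (forall U, G U -> measurable (X @^-1` U)) ->
  (forall U, G' U -> measurable (X' @^-1` U)) ->
  (forall U U', G U -> G' U' ->
    P (X @^-1` U `&` X' @^-1` U') = (P (X @^-1` U) * P (X' @^-1` U'))%E) ->
  forall U U', <<s G >> U -> <<s G' >> U' ->
    P (X @^-1` U `&` X' @^-1` U') = (P (X @^-1` U) * P (X' @^-1` U'))%E.
Proof.
move=> GI GT GI' GT' mX mX' XX'.
have msX U : <<s G >> U -> measurable (X @^-1` U).
  move=> GU; rewrite -[_ @^-1` _]setTI; exact: (measurable_fun_generated mX).
have msX' U : <<s G' >> U -> measurable (X' @^-1` U).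
  move=> GU; rewrite -[_ @^-1` _]setTI; exact: (measurable_fun_generated mX').
have scale (V : set T) : measurable V ->
    exists r : {nonneg R}, r%:num%:E = P V.
  move=> mV; have r0 : 0 <= fine (P V) by rewrite fine_ge0.
  by exists (NngNum r0); rewrite /= fineK // fin_num_measure.
have step1 U U' : <<s G >> U -> G' U' ->
    P (X @^-1` U `&` X' @^-1` U') = (P (X @^-1` U) * P (X' @^-1` U'))%E.
  move=> GU GU'; have mU' := mX' _ GU'; have [r rE] := scale _ mU'.
  have H := @preimage_measure_unique _ _ R _ G X X GI GT mX mX
     (mrestr P mU') (mscale r P).
  rewrite muleC -rE; apply: H GU => //.
    by change (P (setT `&` X' @^-1` U') < +oo)%E; rewrite setTI ltey_eq fin_num_measure.
  move=> V GV; change (P (X @^-1` V `&` X' @^-1` U') = r%:num%:E * P (X @^-1` V))%E.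
  by rewrite XX' // rE muleC.
move=> U U' GU GU'; have mU := msX _ GU; have [r rE] := scale _ mU.
have H := @preimage_measure_unique _ _ R _ G' X' X' GI' GT' mX' mX'
   (mrestr P mU) (mscale r P).
rewrite setIC -rE; apply: H GU' => //.
  by change (P (setT `&` X @^-1` U) < +oo)%E; rewrite setTI ltey_eq fin_num_measure.
move=> V GV; change (P (X' @^-1` V `&` X @^-1` U) = r%:num%:E * P (X' @^-1` V))%E.
by rewrite setIC step1 // rE.
Qed.

End Independence.

(** * Cylinder events over a block of sites, and measurability *)

Section Boxes.
Context {R : realType}.
Local Notation cookies := (nat -> nat -> R).

Definition box (j k : nat) (B : nat -> nat -> set R) : set cookies :=
  [set e | forall x i, (j <= x < k)%N -> B x i (e x i)].

(** Only finitely many cookies per site are constrained, because the independence and the common law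
    of the sites are assumed on finite blocks. *)
Definition box_sides (B : nat -> nat -> set R) :=
  (forall x i, measurable (B x i)) /\
  exists M, forall x i, (M <= i)%N -> B x i = setT.

Definition boxes j k : set (set cookies) :=
  [set U | exists2 B, box_sides B & U = box j k B].

Lemma boxesT j k : boxes j k setT.
Proof.
exists (fun _ _ => setT); first by split => //; exists 0%N.
by apply/seteqP; split => // e _ x i.
Qed.

Lemma boxI j k B B' :
  box j k B `&` box j k B' = box j k (fun x i => B x i `&` B' x i).
Proof.
apply/seteqP; split => e /=.
  by move=> [eB eB'] x i xk; split; [exact: eB|exact: eB'].
by move=> eB; split => x i xk; have [] := eB x i xk.
Qed.

Lemma box_sidesI B B' : box_sides B -> box_sides B' ->
  box_sides (fun x i => B x i `&` B' x i).
Proof.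
move=> [mB [M BM]] [mB' [M' BM']]; split; first by move=> x i; exact: measurableI.
exists (maxn M M') => x i; rewrite geq_max => /andP[Mi Mi'].
by rewrite BM // BM' // setIT.
Qed.

Lemma boxesI j k : setI_closed (boxes j k).
Proof.
move=> _ _ [B sB ->] [B' sB' ->]; rewrite boxI.
by eexists; [exact: box_sidesI sB sB'|].
Qed.

(** Environments with the sigma-algebra of the sites [j] to [k - 1]: measurability on this type
    encodes dependence on these sites only. *)
Definition site_env (j k : nat) := g_sigma_algebraType (boxes j k).

Lemma measurable_site j k x i : (j <= x < k)%N ->
  measurable_fun setT (fun e : site_env j k => e x i).
Proof.
move=> xk _ A mA; rewrite setTI; apply: sub_sigma_algebra.
exists (fun y l => if (y == x) && (l == i) then A else setT).
  split; first by move=> y l; case: ifP.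
  exists i.+1 => y l il; rewrite ifF //; apply/negP => /andP[_ /eqP li].
  by rewrite li ltnn in il.
apply/seteqP; split => e /=.
  by move=> Ae y l _; case: ifP => // /andP[/eqP -> /eqP ->].
by move=> /(_ x i xk); rewrite !eqxx.
Qed.

(* Truncation to admissible cookie strengths: it makes the walk functionals
   well behaved on the whole space, hence measurable. *)
Definition clip (e : cookies) : cookies := fun x i =>
  if i == 0%N then e x i else Num.max 2^-1 (Num.min 1 (e x i)).

Lemma excited_clip e : excited (clip e).
Proof.
move=> x i i0; rewrite /clip gtn_eqF // le_max lexx /=.
by rewrite ge_max ge_min lexx invf_le1 ?ler1n.
Qed.

Lemma clip_id e : excited e -> clip e = e.
Proof.
move=> ve; apply/funext => x; apply/funext => i; rewrite /clip.
have [//|i0] := posnP i; have /andP[p1 p2] := ve x i i0.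
by rewrite (min_idPr p2) (max_idPr p1).
Qed.

Lemma measurable_clip j k x i : (j <= x < k)%N ->
  measurable_fun setT (fun e : site_env j k => clip e x i).
Proof.
move=> xk; rewrite /clip; case: eqP => _; first exact: measurable_site.
apply: measurable_maxr => //; apply: measurable_minr => //; exact: measurable_site.
Qed.

Section MeasurableReach.
Context d (T : measurableType d).

Lemma measurable_hitN n N (A : T -> cookies) x :
  (forall z i, (0 < z < n)%N -> measurable_fun setT (fun t => A t z i)) ->
  measurable_fun setT (fun t => hitN (fun=> 1) n N (A t) x).
Proof.
elim: N A x => [|N IH] A x mA /=; first exact: measurable_cst.
have [x0|x0] := posnP x; first exact: measurable_cst.
case: leqP => xn; first exact: measurable_cst.
have xin : (0 < x < n)%N by rewrite x0.
have meat z i : (0 < z < n)%N -> measurable_fun setT (fun t => eat x (A t) z i).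
  by move=> zn; rewrite /eat; case: eqP => _; exact: mA.
apply: measurable_funD; apply: measurable_funM.
- exact: mA.
- exact: IH.
- by apply: measurable_funB => //; exact: mA.
- exact: IH.
Qed.

Lemma measurable_reach n (A : T -> cookies) x : (forall t, excited (A t)) ->
  (forall z i, (0 < z < n)%N -> measurable_fun setT (fun t => A t z i)) ->
  measurable_fun setT (fun t => reach n (A t) x).
Proof.
move=> vA mA; apply: (measurable_fun_cvg (h := fun N t => hitN (fun=> 1) n N (A t) x)).
  by move=> N; exact: measurable_hitN.
by move=> t _; apply: hitN_cvg => //; exact: unit_valued1.
Qed.

End MeasurableReach.

End Boxes.

(** * The limit of a monotone sequence obeying the renewal-type bounds *)

Section Renewal.
Context {R : realType}.
Variables (r : nat -> R) (q A B : R).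
Hypotheses (r1 : r 1%N = 1) (r_ni : forall n, (0 < n)%N -> r n.+1 <= r n)
  (q0 : 0 <= q) (q_le : forall n, (0 < n)%N -> q <= r n)
  (q_lim : forall e, 0 < e -> exists2 m, (0 < m)%N & r m <= q + e)
  (A0 : 0 <= A) (B0 : 0 < B)
  (r_bounds : forall n, (0 < n)%N ->
    0 <= n%:R * r n - \sum_(1 <= y < n) (A * r y - B * (r y * r (n - y)%N)) <= 1).

Lemma le_linear_slope (x a e : R) :
  (forall n, (0 < n)%N -> x * n%:R <= a + e * n%:R) -> x <= e.
Proof.
move=> H; rewrite leNgt; apply/negP => ex.
have xe : 0 < x - e by rewrite subr_gt0.
have := archi_boundP (_ : 0 <= `|a| / (x - e)).
rewrite divr_ge0 ?(ltW xe) // => /(_ erefl).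
set n := Num.bound _; rewrite ltr_pdivrMr // => an.
have n0 : (0 < n)%N.
  rewrite lt0n; apply/negP => /eqP n0; move: an; rewrite n0 mul0r.
  by rewrite ltNge normr_ge0.
have := H n n0; have := ler_norm a; nra.
Qed.

Let r_ni' m n : (0 < m)%N -> (m <= n)%N -> r n <= r m.
Proof.
move=> m0; elim: n => [|n IH]; first by rewrite leqn0 => /eqP <-.
rewrite leq_eqVlt => /predU1P[-> //|]; rewrite ltnS => mn.
by apply: le_trans (IH mn); apply: r_ni; lia.
Qed.

Let r_le1 n : (0 < n)%N -> r n <= 1.
Proof. by move=> n0; rewrite -r1 r_ni'. Qed.

Let r_ge0 n : (0 < n)%N -> 0 <= r n.
Proof. by move=> n0; apply: le_trans q0 (q_le n0). Qed.

(** Cesàro averaging: the terms before [m] are at most 1 each and the later ones at most [e], whence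
    the intercept [m]. *)
Lemma sum_le_slope (e : R) : 0 < e ->
  exists a, forall n, (0 < n)%N -> \sum_(1 <= y < n) (r y - q) <= a + e * n%:R.
Proof.
move=> e0; have [m m0 rm] := q_lim e0; exists m%:R.
elim=> [//|n IH _]; have [->|n0] := posnP n.
  by rewrite big_geq // addr_ge0 // mulr1 ltW.
rewrite big_nat_recr //=; have [mn|nm] := leqP m n.
  have := IH n0; have := r_ni' m0 mn; rewrite -natr1; lra.
apply: (@le_trans _ _ n%:R).
  rewrite -big_nat_recr //=; apply: (@le_trans _ _ (\sum_(1 <= y < n.+1) 1)).
    rewrite big_nat [X in _ <= X]big_nat ler_sum // => y /andP[y0 _].
    by have := r_le1 y0; have := q0; lra.
  by rewrite sumr_const_nat subn1.
have : n%:R <= m%:R :> R by rewrite ler_nat ltnW.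
have : 0 <= e * n.+1%:R by rewrite mulr_ge0 // ltW.
lra.
Qed.

Let S n := \sum_(1 <= y < n) r y.

Let nr_le n : (0 < n)%N -> n%:R * r n <= S n + r n.
Proof.
case: n => // n _; rewrite -natr1 mulrDl mul1r lerD2r /S.
apply: (@le_trans _ _ (\sum_(1 <= y < n.+1) r n.+1)).
  by rewrite sumr_const_nat subn1 /= mulr_natl.
rewrite big_nat [X in _ <= X]big_nat ler_sum // => y /andP[y0 yn].
by apply: r_ni' => //; exact: ltnW.
Qed.

(** Writing each [r y] as [q] plus an excess in [r_bounds], every error is controlled by the total
    excess [D], which grows sublinearly. *)
Lemma renewal_fixpoint : q - A * q + B * q ^+ 2 = 0.
Proof.
set k := (X in X = 0); apply/eqP; rewrite -normr_le0.
have q1 : q <= 1 by rewrite -r1 q_le.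
have A0' := A0; have B0' := B0; have q0' := q0.
(* This [c] dominates both the coefficient of [D] in the errors, [1 + A + 3 * B], and their constant
   part. *)
pose c := 3 + A + 3 * B; have c0 : 0 < c by rewrite /c; lra.
apply: contraT; rewrite -ltNge => k0.
(* With this slope [c * e] is half of [|k|], which contradicts the bound to be proved. *)
pose e := `|k| / c / 2; have e0 : 0 < e by rewrite /e !divr_gt0.
have [a Ha] := sum_le_slope e0.
suff : `|k| <= c * e.
  have -> : c * e = `|k| / 2 by rewrite /e; field; rewrite gt_eqF.
  by move: k0; set u := `|k|; lra.
apply: (@le_linear_slope _ (c * a + c)) => n n0.
have D0 : 0 <= \sum_(1 <= y < n) (r y - q).
  by rewrite big_nat sumr_ge0 // => y /andP[y0 _]; rewrite subr_ge0 q_le.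
have := Ha n n0; set D := \sum_(_ <= _ < _) _ in D0 *; move=> HD.
have H1 : S n = D + (n%:R - 1) * q.
  rewrite /D /S sumrB sumr_const_nat -[q *+ _]mulr_natl natrB //; ring.
pose dd := \sum_(1 <= y < n) (r y - q) * (r (n - y)%N - q).
have rev : \sum_(1 <= y < n) (r (n - y)%N - q) = D.
  rewrite /D [RHS]big_nat_rev; apply: eq_big_nat => y /andP[y0 yn].
  by congr (r _ - q); lia.
have dd0 : 0 <= dd <= D.
  apply/andP; split.
    by rewrite /dd big_nat sumr_ge0 // => y yn; rewrite mulr_ge0 // subr_ge0 q_le //; lia.
  rewrite /dd /D big_nat [X in _ <= X]big_nat.
  apply: ler_sum => y yn; rewrite ler_piMr ?subr_ge0 ?q_le //; first by lia.
  have : r (n - y)%N <= 1 by apply: r_le1; lia.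
  by lra.
have H2 : \sum_(1 <= y < n) r y * r (n - y)%N = dd + 2 * q * D + (n%:R - 1) * q ^+ 2.
  transitivity (dd + \sum_(1 <= y < n) (q * (r y - q) + q * (r (n - y)%N - q) + q ^+ 2)).
    by rewrite /dd -big_split /=; apply: eq_bigr => y _; ring.
  rewrite !big_split /= -!mulr_sumr rev -/D sumr_const_nat -[_ *+ _]mulr_natl natrB //.
  ring.
have := r_bounds n0; rewrite sumrB -!mulr_sumr -/(S n) H1 H2.
have := nr_le n0; rewrite H1.
have := q_le n0; have := r_le1 n0.
have -> : k = q - A * q + B * q ^+ 2 by [].
set rn := r n; set N := n%:R : R.
have N0 : 1 <= N by rewrite ler1n.
move=> rn1 qrn nr bnd.
have qD : 0 <= q * D <= D by rewrite mulr_ge0 //= ler_piMl.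
have AD : 0 <= A * D by rewrite mulr_ge0.
have BD : 0 <= B * D by rewrite mulr_ge0 // ltW.
have Bdd : 0 <= B * dd <= B * D.
  by rewrite mulr_ge0 ?ler_wpM2l ?(ltW B0) //; case/andP: dd0.
have BqD : 0 <= B * (q * D) <= B * D.
  by rewrite mulr_ge0 ?ler_wpM2l ?(ltW B0) //; case/andP: qD.
have Aq : 0 <= A * q <= A by rewrite mulr_ge0 //= ler_piMr.
have qq : 0 <= q ^+ 2 <= 1 by rewrite exprn_ge0 // exprn_ile1.
have Bqq : 0 <= B * q ^+ 2 <= B.
  by rewrite mulr_ge0 ?ler_piMr ?(ltW B0) //; case/andP: qq.
have Nrn : N * q <= N * rn by rewrite ler_wpM2l //; lra.
have E : (q - A * q + B * q ^+ 2) * N =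
    (N * rn - (A * (D + (N - 1) * q) - B * (dd + 2 * q * D + (N - 1) * q ^+ 2)))
    - (N * rn - N * q) + A * D - A * q - B * dd - 2 * (B * (q * D)) + B * q ^+ 2.
  by ring.
have up : `|(q - A * q + B * q ^+ 2) * N| <= c * D + c.
  by rewrite E ler_norml /c; apply/andP; split; lra.
have -> : `|q - A * q + B * q ^+ 2| * N = `|(q - A * q + B * q ^+ 2) * N|.
  by rewrite normrM (ger0_norm (_ : 0 <= N)) //; lra.
apply: (le_trans up).
have : c * D <= c * (a + e * N) by rewrite ler_wpM2l // ltW.
lra.
Qed.

(** If [A > 1] while [r] tends to 0, the convolution is negligible against [S n], and the lower
    bound in [r_bounds] keeps [r n] above a positive constant. *)
Lemma renewal_subcritical : q = 0 -> A <= 1.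
Proof.
move=> qz; rewrite leNgt; apply/negP => A1.
pose h := (A - 1) / 2; have h0 : 0 < h by rewrite /h; lra.
(* This [m] makes [2 * B * r m] at most [h], half of the surplus [A - 1]. *)
have [m m0] := q_lim (divr_gt0 h0 (mulr_gt0 (ltr0n R 2) B0)).
rewrite qz add0r ler_pdivlMr ?mulr_gt0 // => rm.
have hr n : (2 * m <= n)%N -> h <= r n.
  move=> mn; have n0 : (0 < n)%N by lia.
  have sum2 : \sum_(1 <= y < n) r y * r (n - y)%N <= 2 * r m * S n.
    apply: (@le_trans _ _ (\sum_(1 <= y < n) (r m * r y + r m * r (n - y)%N))).
      rewrite big_nat [X in _ <= X]big_nat; apply: ler_sum => y yn.
      have y0 : 0 <= r y by apply: r_ge0; lia.
      have z0 : 0 <= r (n - y)%N by apply: r_ge0; lia.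
      have rm0 := r_ge0 m0.
      (* As [n] is at least [2 * m], one of [y] and [n - y] is at least [m]. *)
      have [my|ym] := leqP m y.
        have : r y * r (n - y)%N <= r m * r (n - y)%N.
          by rewrite ler_wpM2r // r_ni'.
        by have := mulr_ge0 rm0 y0; lra.
      have : r y * r (n - y)%N <= r y * r m.
        by rewrite ler_wpM2l // r_ni' //; lia.
      by have := mulr_ge0 rm0 z0; lra.
    rewrite big_split /= -!mulr_sumr.
    have -> : \sum_(1 <= y < n) r (n - y)%N = S n.
      rewrite /S [RHS]big_nat_rev; apply: eq_big_nat => y yn.
      by congr r; lia.
    by rewrite -/(S n) -mulrDl; lra.
  have S1 : 1 <= S n.
    rewrite /S big_ltn; last by lia.
    rewrite r1 lerDl big_nat sumr_ge0 // => y yn; apply: r_ge0; lia.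
  have := r_bounds n0; rewrite sumrB -!mulr_sumr -/(S n) => /andP[b _].
  have := nr_le n0.
  have B2 : B * \sum_(1 <= y < n) r y * r (n - y)%N <= B * (2 * r m * S n).
    by rewrite ler_wpM2l // ltW.
  have B3 : r m * (2 * B) * S n <= h * S n by rewrite ler_wpM2r //; lra.
  have hS : h <= h * S n by rewrite ler_peMr // ltW.
  have AE : A * S n = S n + 2 * (h * S n) by rewrite /h; field.
  by move: b; rewrite AE; lra.
have [m' m'0] := q_lim (divr_gt0 h0 (ltr0n R 2)).
have := hr (maxn (2 * m) m') (leq_maxl _ _).
have := r_ni' m'0 (leq_maxr (2 * m) m').
by rewrite qz; lra.
Qed.

(** The quadratic leaves the roots 0 and [(A - 1) / B]; the sign of [A - 1] selects one. *)
Lemma renewal_limit : q = Num.max (A - 1) 0 / B.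
Proof.
have k := renewal_fixpoint.
have [qz|qn] := eqVneq q 0.
  have := renewal_subcritical qz => A1.
  by rewrite (max_idPr _) ?subr_le0 // mul0r.
have qgt : 0 < q by rewrite lt_def qn.
have E : B * q = A - 1.
  by apply: (mulfI qn); lra.
have : 0 < A - 1 by rewrite -E mulr_gt0.
move=> /ltW /max_idPl ->; rewrite -E mulrAC divff ?mul1r //.
by rewrite gt_eqF.
Qed.

End Renewal.

(** * Expectation of bounded random variables *)

Section BoundedExpectation.
Context (d : measure_display) (T : measurableType d) (R : realType)
  (P : probability T R).
Implicit Types F G : T -> R.

Definition bounded_rv F :=
  measurable_fun setT F /\ exists K, forall t, `|F t| <= K.

Lemma bounded_rv_integrable F : bounded_rv F -> P.-integrable setT (EFin \o F).
Proof.
move=> [mF [K FK]]; apply: measurable_bounded_integrable => //.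
  by rewrite ltey_eq fin_num_measure.
exists K; split; first exact: num_real.
by move=> x Kx t _; exact: le_trans (FK t) (ltW Kx).
Qed.

Lemma bounded_rv_unit F : measurable_fun setT F ->
  (forall t, 0 <= F t <= 1) -> bounded_rv F.
Proof.
by move=> mF F1; split => //; exists 1 => t; have /andP[a b] := F1 t; rewrite ger0_norm.
Qed.

Lemma bounded_rv_cst c : bounded_rv (cst c).
Proof. by split => //; exists `|c|. Qed.

Lemma bounded_rvD F G : bounded_rv F -> bounded_rv G ->
  bounded_rv (fun t => F t + G t).
Proof.
move=> [mF [K FK]] [mG [L GL]]; split; first exact: measurable_funD.
by exists (K + L) => t; apply: le_trans (ler_normD _ _) _; exact: lerD.
Qed.

Lemma bounded_rvM F G : bounded_rv F -> bounded_rv G ->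
  bounded_rv (fun t => F t * G t).
Proof.
move=> [mF [K FK]] [mG [L GL]]; split; first exact: measurable_funM.
by exists (K * L) => t; rewrite normrM ler_pM.
Qed.

Lemma bounded_rvB F G : bounded_rv F -> bounded_rv G ->
  bounded_rv (fun t => F t - G t).
Proof.
move=> [mF [K FK]] [mG [L GL]]; split; first exact: measurable_funB.
by exists (K + L) => t; apply: le_trans (ler_normB _ _) _; exact: lerD.
Qed.

Lemma bounded_rv_sum (s : seq nat) (F : nat -> T -> R) :
  {in s, forall y, bounded_rv (F y)} -> bounded_rv (fun t => \sum_(y <- s) F y t).
Proof.
elim: s => [|a s IH] Fs.
  by under eq_fun do rewrite big_nil; exact: bounded_rv_cst.
under eq_fun do rewrite big_cons; apply: bounded_rvD.
  by apply: Fs; rewrite mem_head.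
by apply: IH => y ys; apply: Fs; rewrite inE ys orbT.
Qed.

Local Notation EE F := (Rintegral P setT F).

Lemma EFin_Rintegral F : bounded_rv F -> (\int[P]_t (F t)%:E = (EE F)%:E)%E.
Proof.
by move=> bF; rewrite /Rintegral fineK // integrable_fin_num //; exact: bounded_rv_integrable.
Qed.

Lemma RintegralD_bounded F G : bounded_rv F -> bounded_rv G ->
  EE (fun t => F t + G t) = EE F + EE G.
Proof. by move=> bF bG; rewrite RintegralD //; exact: bounded_rv_integrable. Qed.

Lemma RintegralB_bounded F G : bounded_rv F -> bounded_rv G ->
  EE (fun t => F t - G t) = EE F - EE G.
Proof. by move=> bF bG; rewrite RintegralB //; exact: bounded_rv_integrable. Qed.

Lemma RintegralZ_bounded c F : bounded_rv F -> EE (fun t => c * F t) = c * EE F.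
Proof. by move=> bF; rewrite RintegralZl //; exact: bounded_rv_integrable. Qed.

Lemma Rintegral_sum_bounded (s : seq nat) (F : nat -> T -> R) :
  {in s, forall y, bounded_rv (F y)} ->
  EE (fun t => \sum_(y <- s) F y t) = \sum_(y <- s) EE (F y).
Proof.
elim: s => [|a s IH] Fs.
  under eq_Rintegral do rewrite big_nil; by rewrite big_nil Rintegral_cst // mul0r.
have Fa : bounded_rv (F a) by apply: Fs; rewrite mem_head.
have Fs' : {in s, forall y, bounded_rv (F y)}.
  by move=> y ys; apply: Fs; rewrite inE ys orbT.
under eq_Rintegral do rewrite big_cons.
by rewrite RintegralD_bounded // ?IH ?big_cons //; exact: bounded_rv_sum.
Qed.

Lemma Rintegral_cst_prob (c : R) : EE (fun=> c) = c.
Proof.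
rewrite Rintegral_cst // -[RHS]mulr1; congr (c * _).
by rewrite [X in fine X](_ : _ = 1%E) //; exact: probability_setT.
Qed.

Lemma le_Rintegral_bounded F G : bounded_rv F -> bounded_rv G ->
  (forall t, F t <= G t) -> EE F <= EE G.
Proof. by move=> bF bG FG; rewrite le_Rintegral //; exact: bounded_rv_integrable. Qed.

Lemma Rintegral_unit F : measurable_fun setT F -> (forall t, 0 <= F t <= 1) ->
  0 <= EE F <= 1.
Proof.
move=> mF F1; have bF := bounded_rv_unit mF F1; apply/andP; split.
  by rewrite -[X in X <= _]Rintegral_cst_prob le_Rintegral_bounded //;
     [exact: bounded_rv_cst|move=> t; case/andP: (F1 t)].
by rewrite -[X in _ <= X]Rintegral_cst_prob le_Rintegral_bounded //;
   [exact: bounded_rv_cst|move=> t; case/andP: (F1 t)].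
Qed.

Lemma ae_eq_Rintegral F G : measurable_fun setT F -> measurable_fun setT G ->
  {ae P, forall t, F t = G t} -> EE F = EE G.
Proof.
move=> mF mG FG; rewrite /Rintegral; congr fine; apply: ae_eq_integral => //.
- exact/measurable_EFinP.
- exact/measurable_EFinP.
- by apply: filterS FG => t /= FGt _; rewrite FGt.
Qed.

Lemma Rintegral_unit_ae F : measurable_fun setT F ->
  {ae P, forall t, 0 <= F t <= 1} -> 0 <= EE F <= 1.
Proof.
(* Truncation turns the almost sure bounds into everywhere bounds. *)
move=> mF F1; pose G t := Num.max 0 (Num.min 1 (F t)).
have mG : measurable_fun setT G.
  by apply: measurable_maxr => //; exact: measurable_minr.
rewrite (@ae_eq_Rintegral F G) //.
  apply: Rintegral_unit => // t; rewrite /G le_max lexx /=.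
  by rewrite ge_max ler01 ge_min lexx.
by apply: filterS F1 => t /= /andP[a b]; rewrite /G (min_idPr b) (max_idPr a).
Qed.

Lemma Rintegral_cvg (F : nat -> T -> R) G : bounded_rv G ->
  (forall n, measurable_fun setT (F n)) -> (forall n t, `|F n t| <= 1) ->
  (forall t, F n t @[n --> \oo] --> G t) ->
  EE (F n) @[n --> \oo] --> EE G.
Proof.
move=> bG mF F1 FG.
have bF n : bounded_rv (F n) by split => //; exists 1.
apply: fine_cvg; rewrite -/(Rintegral P setT G) -(EFin_Rintegral bG).
apply: (@dominated_cvg _ _ _ P setT measurableT (fun n t => (F n t)%:E)
  (fun t => (G t)%:E) (cst 1%E)) => //.
- by move=> n; exact/measurable_EFinP.
- by move=> t _; apply: cvg_EFin; [near=> n|exact: FG].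
- by have := bounded_rv_integrable (bounded_rv_cst 1).
- by move=> n t _; rewrite /= lee_fin.
Unshelve. all: by end_near. Qed.

End BoundedExpectation.

(** * Functionals that read only a block of sites *)

Section LocalFunctionals.
Context {R : realType}.
Local Notation cookies := (nat -> nat -> R).

Definition local_fun j k (F : cookies -> R) :=
  measurable_fun setT (fun e : site_env j k => F (clip e)) /\
  forall e, excited e -> 0 <= F e <= 1.

Lemma local_reach j n x : (j <= 1)%N -> local_fun j n (fun e => reach n e x).
Proof.
move=> j1; split; last by move=> e ve; exact: reach_range.
apply: measurable_reach => [t|z i zn]; first exact: excited_clip.
by apply: measurable_clip; lia.
Qed.

Lemma local_reach_translate y n x :
  local_fun y n (fun e => reach (n - y) (translate y e) x).
Proof.
split; last by move=> e ve; exact/reach_range/excited_translate.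
apply: measurable_reach => [t|z i zn]; first exact/excited_translate/excited_clip.
by apply: measurable_clip; lia.
Qed.

Lemma local_funM j k F G : local_fun j k F -> local_fun j k G ->
  local_fun j k (fun e => F e * G e).
Proof.
move=> [mF F1] [mG G1]; split; first exact: measurable_funM.
move=> e ve; have /andP[a b] := F1 e ve; have /andP[a' b'] := G1 e ve.
by rewrite mulr_ge0 // mulr_ile1.
Qed.

Lemma local_drift j k y i : (j <= y < k)%N -> (0 < i)%N ->
  local_fun j k (fun e => 2 * e y i - 1).
Proof.
move=> yk i0; split; last by move=> e ve; have := ve y i i0; lra.
by apply: measurable_funB => //; apply: measurable_funM => //; exact: measurable_clip.
Qed.

Lemma local_cookie j k y i : (j <= y < k)%N -> (0 < i)%N ->
  local_fun j k (fun e => e y i).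
Proof.
move=> yk i0; split; last by move=> e ve; have := ve y i i0; lra.
exact: measurable_clip.
Qed.

End LocalFunctionals.

(** * Averaging over an i.i.d. environment *)

Section Annealed.
Context (d : measure_display) (T : measurableType d)
  (R : realType) (P : probability T R) (omega : T -> int -> nat -> R).
Hypothesis omega_meas : forall (x : int) (i : nat),
      measurable_fun setT (fun t => omega t x i).
Hypothesis omega_range : forall t (x : int) (i : nat), (1 <= i)%N ->
      2^-1 <= omega t x i <= 1.
Hypothesis omega_indep : forall (N M : nat) (B : nat -> nat -> set R),
      (forall x i, measurable (B x i)) ->
      P (\bigcap_(x in [set x | (x < N)%N])
           \bigcap_(i in [set i | (i < M)%N])
             [set t | B x i (omega t x%:Z i)]) =
      (\prod_(x < N)
         P (\bigcap_(i in [set i | (i < M)%N])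
              [set t | B x i (omega t (nat_of_ord x)%:Z i)]))%E.
Hypothesis omega_ident : forall (x M : nat) (B : nat -> set R),
      (forall i, measurable (B i)) ->
      P (\bigcap_(i in [set i | (i < M)%N]) [set t | B i (omega t x%:Z i)]) =
      P (\bigcap_(i in [set i | (i < M)%N]) [set t | B i (omega t 0%R i)]).

Definition env_at a t : nat -> nat -> R := fun x i => omega t (a + x)%N%:Z i.

Lemma excited_env a t : excited (env_at a t).
Proof. by move=> x i i0; exact: omega_range. Qed.

Lemma measurable_env_coord a x i : measurable_fun setT (fun t => env_at a t x i).
Proof. exact: omega_meas. Qed.

Lemma measurable_env_box a j k U : boxes j k U -> measurable (env_at a @^-1` U).
Proof.
move=> [B [mB _] ->].
have -> : env_at a @^-1` box j k B =
    \bigcap_x \bigcap_i [set t | (j <= x < k)%N -> B x i (env_at a t x i)].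
  by apply/seteqP; split => t /= H x; [move=> _ i _; exact: H|move=> i; exact: H].
apply: bigcapT_measurable => x; apply: bigcapT_measurable => i.
have [xk|xk] := boolP (j <= x < k)%N.
  rewrite (_ : mkset _ = (fun t => env_at a t x i) @^-1` B x i); last first.
    by apply/seteqP; split => t /=; [exact|].
  by rewrite -[X in measurable X]setTI; exact: measurable_env_coord.
by rewrite (_ : mkset _ = setT) //; apply/seteqP; split.
Qed.

(** Each factor is expressed through site 0, so the value does not depend on [a]; stationarity and
    independence of blocks both follow. *)
Lemma env_box_probability a j k B : (j <= k)%N -> box_sides B ->
  P (env_at a @^-1` box j k B) =
  (\prod_(j <= x < k) P [set t | forall i, B x i (omega t 0 i)])%E.
Proof.
move=> jk [mB [M BM]].
(* The independence hypothesis concerns all sites from 0 up, so those before [a + j] get trivial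
   constraints. *)
pose B' x i := if (a + j <= x)%N then B (x - a)%N i else setT.
have -> : env_at a @^-1` box j k B = \bigcap_(x in [set x | (x < a + k)%N])
    \bigcap_(i in [set i | (i < M)%N]) [set t | B' x i (omega t x%:Z i)].
  apply/seteqP; split => t /= H.
    move=> x /= xk i _; rewrite /B' /=; case: leqP => // jx.
    have := H (x - a)%N i; rewrite /env_at subnKC; last by lia.
    by apply; lia.
  move=> x i xk; have [Mi|iM] := leqP M i; first by rewrite BM.
  have := H (a + x)%N _ i iM; rewrite /= /B' ifT; last by lia.
  by rewrite addKn; apply; rewrite /=; lia.
rewrite omega_indep; last by move=> x i; rewrite /B'; case: ifP.
rewrite -(big_mkord xpredT (fun x => P (\bigcap_(i in [set i | (i < M)%N])
              [set t | B' x i (omega t x%:Z i)]))).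
rewrite (@big_cat_nat _ _ _ (a + j)%N) //=; last by lia.
rewrite big_nat big1 ?mul1e; last first.
  move=> x /andP[_ xj]; rewrite (_ : bigcap _ _ = setT) ?probability_setT //.
  by apply/seteqP; split => // t _ i _; rewrite /= /B' leqNgt xj.
rewrite -{1}[(a + j)%N]addnC big_addn.
have -> : (a + k - a = k)%N by lia.
apply: eq_big_nat => x /andP[jx xk].
rewrite omega_ident; last by move=> i; rewrite /B'; case: ifP.
congr (P _); apply/seteqP; split => t /= H.
  move=> i; have [Mi|iM] := leqP M i; first by rewrite BM.
  have := H i iM; rewrite /= /B' ifT; last by lia.
  by rewrite addnK.
move=> i /= iM; rewrite /B'; case: ifP => // _; rewrite addnK; exact: H.
Qed.

Lemma env_stationary a j k (f : site_env (R := R) j k -> R) : (j <= k)%N ->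
  measurable_fun setT f -> (forall e, 0 <= f e) ->
  (\int[P]_t (f (env_at a t))%:E = \int[P]_t (f (env_at 0 t))%:E)%E.
Proof.
move=> jk mf f0.
have mE b : measurable_fun setT (env_at b : T -> site_env (R := R) j k).
  by apply: measurable_fun_generated => U; exact: measurable_env_box.
apply: eq_integral_law => //.
- exact: (measurableT_comp mf (mE a)).
- exact: (measurableT_comp mf (mE 0%N)).
move=> A mA.
have GA : <<s boxes j k >> (f @^-1` A) by rewrite -[_ @^-1` _]setTI; exact: mf.
apply: (@preimage_measure_unique _ _ R _ (boxes j k) (env_at a) (env_at 0)) GA.
- exact: boxesI.
- exact: boxesT.
- exact: measurable_env_box.
- exact: measurable_env_box.
- by rewrite ltey_eq fin_num_measure.
- move=> U [B sB ->]; exact: etrans (env_box_probability a jk sB)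
    (esym (env_box_probability 0 jk sB)).
Qed.

Lemma env_independent a i j k (f : site_env (R := R) i j -> R)
    (g : site_env (R := R) j k -> R) : (i <= j)%N -> (j <= k)%N ->
  measurable_fun setT f -> measurable_fun setT g ->
  (forall e, 0 <= f e) -> (forall e, 0 <= g e) ->
  (\int[P]_t (f (env_at a t) * g (env_at a t))%:E =
   (\int[P]_t (f (env_at a t))%:E) * (\int[P]_t (g (env_at a t))%:E))%E.
Proof.
move=> ij jk mf mg f0 g0.
have mE j' k' : measurable_fun setT (env_at a : T -> site_env (R := R) j' k').
  by apply: measurable_fun_generated => U; exact: measurable_env_box.
apply: integralM_indep => //.
- exact: (measurableT_comp mf (mE i j)).
- exact: (measurableT_comp mg (mE j k)).
move=> A A' mA mA'.
have GA : <<s boxes i j >> (f @^-1` A) by rewrite -[_ @^-1` _]setTI; exact: mf.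
have GA' : <<s boxes j k >> (g @^-1` A') by rewrite -[_ @^-1` _]setTI; exact: mg.
apply: (@preimage_indep _ _ R P _ _ (boxes i j) (boxes j k) (env_at a) (env_at a)) GA GA'.
- exact: boxesI.
- exact: boxesT.
- exact: boxesI.
- exact: boxesT.
- exact: measurable_env_box.
- exact: measurable_env_box.
move=> _ _ [B sB ->] [B' sB' ->].
(* The two boxes glue into one over adjacent blocks, whose product of probabilities splits at
   [j]. *)
pose C x l := if (x < j)%N then B x l else B' x l.
have sC : box_sides C.
  case: sB => mB [M BM]; case: sB' => mB' [M' BM']; split.
    by move=> x l; rewrite /C; case: ifP.
  exists (maxn M M') => x l; rewrite geq_max => /andP[Ml Ml'].
  by rewrite /C; case: ifP => _; rewrite ?BM ?BM'.
rewrite -preimage_setI.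
have -> : box i j B `&` box j k B' = box i k C.
  apply/seteqP; split => e /=.
    move=> [eB eB'] x l xk; rewrite /C; case: ltnP => xj; [apply: eB|apply: eB']; lia.
  move=> eC; split => x l xk; have := eC x l; rewrite /C.
    by rewrite ifT; [apply; lia|lia].
  by rewrite ifF; [apply; lia|lia].
rewrite !env_box_probability //; last by lia.
rewrite (@big_cat_nat _ _ _ j) //=; congr (_ * _)%E; apply: eq_big_nat => x xk;
  congr (P _); apply/seteqP; split => t /= H l; have := H l; rewrite /C.
- by rewrite ifT //; lia.
- by rewrite ifT //; lia.
- by rewrite ifF //; lia.
- by rewrite ifF //; lia.
Qed.

Local Notation EE F := (Rintegral P setT F).

Lemma bounded_local a j k F : local_fun j k F ->
  bounded_rv (fun t => F (env_at a t)).
Proof.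
move=> [mF F1]; apply: bounded_rv_unit => [|t]; last exact/F1/excited_env.
have mE : measurable_fun setT (env_at a : T -> site_env (R := R) j k).
  by apply: measurable_fun_generated => U; exact: measurable_env_box.
have := measurableT_comp mF mE; congr measurable_fun.
by apply/funext => t /=; rewrite clip_id //; exact: excited_env.
Qed.

Lemma Rintegral_stationary a j k F : (j <= k)%N -> local_fun j k F ->
  EE (fun t => F (env_at a t)) = EE (fun t => F (env_at 0 t)).
Proof.
move=> jk [mF F1].
have := env_stationary a jk mF; rewrite /Rintegral.
have cE b : (fun t => (F (clip (env_at b t)))%:E) = EFin \o (fun t => F (env_at b t)).
  by apply/funext => t /=; rewrite clip_id //; exact: excited_env.
rewrite !cE => -> // e.
by have /andP[] := F1 _ (excited_clip e).
Qed.

Lemma Rintegral_independent a i j k F G : (i <= j)%N -> (j <= k)%N ->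
  local_fun i j F -> local_fun j k G ->
  EE (fun t => F (env_at a t) * G (env_at a t)) =
  EE (fun t => F (env_at a t)) * EE (fun t => G (env_at a t)).
Proof.
move=> ij jk lF lG.
have bF := bounded_local a lF; have bG := bounded_local a lG.
have bFG := bounded_rvM bF bG.
have [mF F1] := lF; have [mG G1] := lG.
have := env_independent a ij jk mF mG.
have cE b : (fun t => (F (clip (env_at b t)))%:E) = (fun t => (F (env_at b t))%:E).
  by apply/funext => t /=; rewrite clip_id //; exact: excited_env.
have cE' b : (fun t => (G (clip (env_at b t)))%:E) = (fun t => (G (env_at b t))%:E).
  by apply/funext => t /=; rewrite clip_id //; exact: excited_env.
have cE2 b : (fun t => (F (clip (env_at b t)) * G (clip (env_at b t)))%:E) =
    (fun t => (F (env_at b t) * G (env_at b t))%:E).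
  by apply/funext => t /=; rewrite clip_id //; exact: excited_env.
rewrite cE cE' cE2 (EFin_Rintegral P bF) (EFin_Rintegral P bG) (EFin_Rintegral P bFG).
move=> H; have {}H := H (fun e => proj1 (andP (F1 _ (excited_clip e))))
  (fun e => proj1 (andP (G1 _ (excited_clip e)))).
by move: H; rewrite -EFinM => -[].
Qed.

(** * The annealed recursion and its coefficients *)

Definition annealed_reach n : R := EE (fun t => reach n (env_at 0 t) 1).
Local Notation r := annealed_reach.

Lemma env_at_site a t : env_at a t 0 = env_at 0 t a.
Proof. by apply/funext => i; rewrite /env_at addn0 add0n. Qed.

Lemma expect_reach_site y (phi : (nat -> R) -> R) :
  (forall j k z, (j <= z < k)%N -> local_fun j k (fun e => phi (e z))) ->
  EE (fun t => reach y (env_at 0 t) 1 * phi (env_at 0 t y)) =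
  r y * EE (fun t => phi (env_at 0 t 0%N)).
Proof.
move=> lphi.
rewrite (@Rintegral_independent 0 0 y y.+1 (fun e => reach y e 1)
  (fun e => phi (e y))) //; last 2 first.
- exact: local_reach.
- by apply: lphi; rewrite leqnn ltnSn.
congr (_ * _).
rewrite -(@Rintegral_stationary y 0 1 (fun e => phi (e 0%N))) //; last exact: lphi.
by apply: eq_Rintegral => t _; rewrite env_at_site.
Qed.

(** The three factors read the sites before [y], the site [y], and the sites after it; the last two
    are moved back to the origin by stationarity. *)
Lemma expect_reach_site_reach y n (phi : (nat -> R) -> R) :
  (forall j k z, (j <= z < k)%N -> local_fun j k (fun e => phi (e z))) ->
  (y < n)%N ->
  EE (fun t => reach y (env_at 0 t) 1 *
     (phi (env_at 0 t y) * reach (n - y) (translate y (env_at 0 t)) 1)) =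
  r y * (EE (fun t => phi (env_at 0 t 0%N)) * r (n - y)).
Proof.
move=> lphi yn; have yn' := ltnW yn.
rewrite (@Rintegral_independent 0 0 y n (fun e => reach y e 1)
  (fun e => phi (e y) * reach (n - y) (translate y e) 1)) //; last 2 first.
- exact: local_reach.
- apply: local_funM; last exact: local_reach_translate.
  by apply: lphi; rewrite leqnn yn.
congr (_ * _).
transitivity (EE (fun t => phi (env_at y t 0%N) * reach (n - y) (env_at y t) 1)).
  by apply: eq_Rintegral => t _; rewrite env_at_site.
rewrite (@Rintegral_independent y 0 1 (n - y) (fun e => phi (e 0%N))
  (fun e => reach (n - y) e 1)) //; last 3 first.
- by lia.
- exact: lphi.
- exact: local_reach.
rewrite (@Rintegral_stationary y 0 1 (fun e => phi (e 0%N))) //; last exact: lphi.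
rewrite (@Rintegral_stationary y 0 (n - y) (fun e => reach (n - y) e 1)) //.
exact: local_reach.
Qed.

Hypothesis only_two :
  {ae P, forall t, forall i : nat, (3 <= i)%N -> omega t 0%R i = 2^-1%R}.

Lemma two_cookies_ae : {ae P, forall t, forall n, two_cookies n (env_at 0 t)}.
Proof.
have H : {ae P, forall t, forall z i, (2 < i)%N -> omega t z%:Z i = 2^-1}.
  apply: ae_foralln => z; apply: ae_foralln => i.
  have [i2|i2] := ltnP 2 i; last by apply: aeW => t.
  (* A box that constrains only cookie [i] carries the almost sure property from site 0 to site
     [z]. *)
  pose B l : set R := if l == i then ~` [set 2^-1] else setT.
  have mB l : measurable (B l).
    by rewrite /B; case: ifP => // _; exact: measurableC.
  have E z' : \bigcap_(l in [set l | (l < i.+1)%N]) [set t | B l (omega t z' l)] =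
      [set t | omega t z' i <> 2^-1].
    apply/seteqP; split => t /= Ht.
      by have := Ht i (ltnSn i); rewrite /B eqxx.
    by move=> l _ /=; rewrite /B; case: eqP => [->|].
  have := omega_ident z i.+1 mB; rewrite !E => Pz.
  have mz z' : measurable [set t | omega t z' i <> 2^-1].
    rewrite (_ : [set t | _] = (fun t => omega t z' i) @^-1` (~` [set 2^-1])) //.
    by rewrite -[X in measurable X]setTI; apply: omega_meas => //; exact: measurableC.
  have P0 : P [set t | omega t 0 i <> 2^-1] = 0%E.
    apply: measure_negligible; first exact: mz.
    by apply: negligibleS only_two => t /= Ht /(_ i i2).
  exists [set t | omega t z%:Z i <> 2^-1]; split => //; first exact: etrans Pz P0.
  by move=> t /= Ht E'; apply: Ht => _.
by apply: filterS H => t /= Ht n z i _ i2; exact: Ht.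
Qed.

Local Notation drift1 := (EE (fun t => 2 * env_at 0 t 0%N 1%N - 1)).
Local Notation drift2 := (EE (fun t => 2 * env_at 0 t 0%N 2%N - 1)).
Local Notation coupling :=
  (EE (fun t => (2 * env_at 0 t 0%N 2%N - 1) * env_at 0 t 0%N 1%N)).

Lemma annealed_reach_bounds n : (0 < n)%N ->
  0 <= n%:R * r n - \sum_(1 <= y < n)
    ((drift1 + drift2) * r y - coupling * (r y * r (n - y)%N)) <= 1.
Proof.
move=> n0.
pose G y t := reach y (env_at 0 t) 1 * (2 * env_at 0 t y 1%N - 1) +
    reach y (env_at 0 t) 1 * (2 * env_at 0 t y 2%N - 1) -
    reach y (env_at 0 t) 1 * ((2 * env_at 0 t y 2%N - 1) * env_at 0 t y 1%N *
        reach (n - y) (translate y (env_at 0 t)) 1).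
have br m : bounded_rv (fun t => reach m (env_at 0 t) 1).
  exact: bounded_local (local_reach m 1 (leqnn 1)).
have bd y i : (0 < i)%N -> bounded_rv (fun t => 2 * env_at 0 t y i - 1).
  by move=> i0; apply: (bounded_local 0 (local_drift (j := 0) (k := y.+1) _ i0)); rewrite ltnSn.
have bc y i : (0 < i)%N -> bounded_rv (fun t => env_at 0 t y i).
  by move=> i0; apply: (bounded_local 0 (local_cookie (j := 0) (k := y.+1) _ i0)); rewrite ltnSn.
have bt y : bounded_rv (fun t => reach (n - y) (translate y (env_at 0 t)) 1).
  exact: bounded_local (local_reach_translate y n 1).
have b1 y i : (0 < i)%N ->
    bounded_rv (fun t => reach y (env_at 0 t) 1 * (2 * env_at 0 t y i - 1)).
  by move=> i0; apply: bounded_rvM => //; exact: bd.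
have b2 y : bounded_rv (fun t => reach y (env_at 0 t) 1 *
    ((2 * env_at 0 t y 2%N - 1) * env_at 0 t y 1%N *
        reach (n - y) (translate y (env_at 0 t)) 1)).
  apply: bounded_rvM => //; apply: bounded_rvM => //; apply: bounded_rvM.
    exact: bd.
  exact: bc.
have bG y : bounded_rv (G y).
  by apply: bounded_rvB => //; apply: bounded_rvD; exact: b1.
have EG y : (y < n)%N ->
    EE (G y) = (drift1 + drift2) * r y - coupling * (r y * r (n - y)%N).
  move=> yn; rewrite RintegralB_bounded //; last by apply: bounded_rvD; exact: b1.
  rewrite RintegralD_bounded; [|exact: b1|exact: b1].
  rewrite (@expect_reach_site y (fun c => 2 * c 1%N - 1)); last first.
    by move=> j k z zk; exact: local_drift.
  rewrite (@expect_reach_site y (fun c => 2 * c 2%N - 1)); last first.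
    by move=> j k z zk; exact: local_drift.
  rewrite (@expect_reach_site_reach y n (fun c => (2 * c 2%N - 1) * c 1%N)) //; last first.
    by move=> j k z zk; apply: local_funM; [exact: local_drift|exact: local_cookie].
  by ring.
have bS : bounded_rv (fun t => \sum_(y <- index_iota 1 n) G y t).
  by apply: bounded_rv_sum => y _.
have bN : bounded_rv (fun t => n%:R * reach n (env_at 0 t) 1).
  by apply: bounded_rvM => //; exact: bounded_rv_cst.
have -> : \sum_(1 <= y < n) ((drift1 + drift2) * r y - coupling * (r y * r (n - y)%N)) =
    EE (fun t => \sum_(y <- index_iota 1 n) G y t).
  rewrite Rintegral_sum_bounded //; apply: eq_big_nat => y /andP[_ yn].
  by rewrite EG.
rewrite /annealed_reach -RintegralZ_bounded // -RintegralB_bounded //.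
apply: Rintegral_unit_ae; first by have [] := bounded_rvB bN bS.
apply: filterS two_cookies_ae => t /= te.
by apply: reach_bounds => //; exact: excited_env.
Qed.

Lemma annealed_stay :
  bounded_rv (fun t => stay (env_at 0 t) 1) /\
  r n.+1 @[n --> \oo] --> EE (fun t => stay (env_at 0 t) 1).
Proof.
have br m : bounded_rv (fun t => reach m (env_at 0 t) 1).
  exact: bounded_local (local_reach m 1 (leqnn 1)).
have cv t : reach n.+1 (env_at 0 t) 1 @[n --> \oo] --> stay (env_at 0 t) 1.
  exact/reach_cvg_stay/excited_env.
have bs : bounded_rv (fun t => stay (env_at 0 t) 1).
  apply: bounded_rv_unit; last by move=> t; exact/stay_range/excited_env.
  apply: (measurable_fun_cvg (h := fun n t => reach n.+1 (env_at 0 t) 1)).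
    by move=> n; have [] := br n.+1.
  by move=> t _.
split=> //; apply: Rintegral_cvg => //.
  by move=> n; have [] := br n.+1.
move=> n t; have /andP[a b] := reach_range n.+1 1 (excited_env 0 t).
by rewrite ger0_norm.
Qed.

(** Survival reads infinitely many sites, so independence is used for each finite barrier and passed
    to the limit by dominated convergence. *)
Lemma expect_cookie_stay :
  EE (fun t => env_at 0 t 0%N 1%N * stay (env_at 0 t) 1) =
  EE (fun t => env_at 0 t 0%N 1%N) * EE (fun t => stay (env_at 0 t) 1).
Proof.
have br m : bounded_rv (fun t => reach m (env_at 0 t) 1).
  exact: bounded_local (local_reach m 1 (leqnn 1)).
have lc : local_fun 0 1 (fun e : nat -> nat -> R => e 0%N 1%N) by exact: local_cookie.
have bc := bounded_local 0 lc.
have [bs cs] := annealed_stay.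
have c1 : EE (fun t => env_at 0 t 0%N 1%N * reach n.+1 (env_at 0 t) 1) @[n --> \oo]
    --> EE (fun t => env_at 0 t 0%N 1%N * stay (env_at 0 t) 1).
  apply: Rintegral_cvg.
  - exact: bounded_rvM.
  - by move=> n; have [] := bounded_rvM bc (br n.+1).
  - move=> n t; have /andP[a b] := reach_range n.+1 1 (excited_env 0 t).
    have := excited_env 0 t 0%N (erefl : (0 < 1)%N) => H.
    by rewrite normrM mulr_ile1 // ger0_norm //; lra.
  - by move=> t; apply: cvgMr; exact/reach_cvg_stay/excited_env.
have c2 : EE (fun t => env_at 0 t 0%N 1%N * reach n.+1 (env_at 0 t) 1) @[n --> \oo]
    --> EE (fun t => env_at 0 t 0%N 1%N) * EE (fun t => stay (env_at 0 t) 1).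
  rewrite (_ : (fun n => _) = fun n => EE (fun t => env_at 0 t 0%N 1%N) * r n.+1).
    exact: cvgMr.
  apply/funext => n.
  rewrite (@Rintegral_independent 0 0 1 n.+1 (fun e => e 0%N 1%N) (fun e => reach n.+1 e 1)) //.
  exact: local_reach.
exact: cvg_unique c1 c2.
Qed.

Lemma expect_delta0 : fine (\int[P]_t delta0 (omega t))%E = drift1 + drift2.
Proof.
have bd i : (0 < i)%N -> bounded_rv (fun t => 2 * env_at 0 t 0%N i - 1).
  by move=> i0; apply: (bounded_local 0 (local_drift (j := 0) (k := 1) _ i0)).
rewrite -RintegralD_bounded; [|exact: bd|exact: bd].
rewrite /Rintegral; congr fine.
have dge t i : (1 <= i)%N -> (0 <= (2 * omega t 0 i - 1)%:E)%E.
  by move=> i1; rewrite lee_fin; have := omega_range t 0 i1; lra.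
have dcvg t : (\sum_(1 <= i < n) (2 * omega t 0 i - 1)%:E)%E @[n --> \oo]
    --> delta0 (omega t).
  by apply: is_cvg_ereal_nneg_natsum => i; exact: dge.
apply: ae_eq_integral => //.
- apply: (emeasurable_fun_cvg
    (fun n t => (\sum_(1 <= i < n) (2 * omega t 0 i - 1)%:E)%E)) => //.
  move=> n; apply: emeasurable_sum => i; apply/measurable_EFinP.
  by apply: measurable_funB => //; exact: measurable_funM.
- by apply/measurable_EFinP; have [] := bounded_rvD (bd 1%N erefl) (bd 2%N erefl).
apply: filterS only_two => t /= te _.
apply/(cvg_unique _ (dcvg t)); first exact: ereal_hausdorff.
(* Almost surely the partial sums are constant once both cookies are included. *)
apply: cvg_near_cst; near=> n.
have n2 : (2 < n)%N by near: n; exists 3%N.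
rewrite big_ltn; last by lia.
rewrite big_ltn; last by lia.
rewrite big_nat big1 ?adde0 // => i /andP[i3 _].
by rewrite te // divff // subrr.
Unshelve. all: by end_near. Qed.

Hypothesis second_nontriv : (P [set t | omega t 0%R 2%N = 2^-1%R] < 1)%E.

(** A nonnegative variable of mean zero vanishes almost surely; as the first cookie is at least 1/2,
    the second would almost surely be neutral, against [second_nontriv]. *)
Lemma coupling_gt0 : 0 < coupling.
Proof.
pose F t := (2 * env_at 0 t 0%N 2%N - 1) * env_at 0 t 0%N 1%N.
have lF : local_fun (R := R) 0 1 (fun e => (2 * e 0%N 2%N - 1) * e 0%N 1%N).
  by apply: local_funM; [exact: local_drift|exact: local_cookie].
have bF : bounded_rv F by exact: (bounded_local 0 lF).
have F0 t : 0 <= F t by have /andP[] := lF.2 _ (excited_env 0 t).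
have EF0 : 0 <= EE F by apply: Rintegral_ge0 => t _; exact: F0.
rewrite lt_neqAle EF0 andbT eq_sym; apply/negP => /eqP E0.
have mF : measurable_fun setT (fun t => (F t)%:E).
  by apply/measurable_EFinP; have [] := bF.
have : (\int[P]_t `|(F t)%:E| = 0)%E.
  rewrite (eq_integral (fun t => (F t)%:E)).
    by rewrite (EFin_Rintegral P bF) E0.
  by move=> t _; rewrite gee0_abs // lee_fin.
move=> /(ae_eq_integral_abs P measurableT mF) ae0.
have mS : measurable [set t | omega t 0 2%N = 2^-1].
  rewrite (_ : [set t | _] = (fun t => omega t 0 2%N) @^-1` [set 2^-1]) //.
  by rewrite -[X in measurable X]setTI; apply: omega_meas.
move: second_nontriv; rewrite -[X in P X]setCK probability_setC; last exact: measurableC.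
rewrite (_ : P (~` _) = 0%E) ?sube0 ?ltxx //.
apply: measure_negligible; first exact: measurableC.
apply: negligibleS ae0 => t /= Ht H; apply: Ht.
have := H I => -[]; rewrite /F /env_at add0n => /eqP.
have H1 := omega_range t 0 (erefl : (1 <= 1)%N).
rewrite mulf_eq0 => /orP[/eqP|/eqP] z; last by lra.
by lra.
Qed.

Lemma expect_stay :
  EE (fun t => stay (env_at 0 t) 1) =
  Num.max (fine (\int[P]_t delta0 (omega t))%E - 1) 0 / coupling.
Proof.
have [bs cs] := annealed_stay.
have br m : bounded_rv (fun t => reach m (env_at 0 t) 1).
  exact: (bounded_local 0 (local_reach m 1 (leqnn 1))).
rewrite expect_delta0; apply: (@renewal_limit _ r).
- rewrite /annealed_reach -[RHS](Rintegral_cst_prob P); apply: eq_Rintegral => t _.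
  by rewrite reach_end //; exact: excited_env.
- move=> n n0; apply: le_Rintegral_bounded => // t.
  by apply: reach_leS => //; exact: excited_env.
- by apply: Rintegral_ge0 => t _; have /andP[] := stay_range 1 (excited_env 0 t).
- move=> n n0; apply: le_Rintegral_bounded => // t.
  by apply: stay_le_reach => //; exact: excited_env.
- move=> e e0; set q := EE _ in cs *.
  move/cvgrPdist_lt : cs => /(_ e e0)[m _ /(_ m (leqnn m)) /= qm].
  by exists m.+1 => //; move: qm; rewrite ltr_norml => /andP[]; lra.
- have dr i : (0 < i)%N -> 0 <= EE (fun t => 2 * env_at 0 t 0%N i - 1).
    move=> i0; apply: Rintegral_ge0 => t _.
    by have := excited_env 0 t 0%N i0; lra.
  by rewrite addr_ge0 // dr.
- exact: coupling_gt0.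
- exact: annealed_reach_bounds.
Qed.

Lemma expect_quenched_pos_forever :
  EE (fun t => quenched_pos_forever (omega t)) =
  EE (fun t => env_at 0 t 0%N 1%N) * EE (fun t => stay (env_at 0 t) 1).
Proof.
rewrite -expect_cookie_stay; apply: eq_Rintegral => t _.
by rewrite quenched_pos_foreverE //; exact: (excited_env 0 t).
Qed.

End Annealed.

Theorem mainTheorem18 (d : measure_display) (T : measurableType d)
  (R : realType) (P : probability T R) (omega : T -> int -> nat -> R)
  (* each coordinate omega(x,i) is a random variable *)
  (omega_meas : forall (x : int) (i : nat),
      measurable_fun setT (fun t => omega t x i))
  (* the environment lies in Omega_+ *)
  (omega_range : forall t (x : int) (i : nat), (1 <= i)%N ->
      2^-1 <= omega t x i <= 1)
  (* (omega(x))_{x >= 0} independent *)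
  (omega_indep : forall (N M : nat) (B : nat -> nat -> set R),
      (forall x i, measurable (B x i)) ->
      P (\bigcap_(x in [set x | (x < N)%N])
           \bigcap_(i in [set i | (i < M)%N])
             [set t | B x i (omega t x%:Z i)]) =
      (\prod_(x < N)
         P (\bigcap_(i in [set i | (i < M)%N])
              [set t | B x i (omega t (nat_of_ord x)%:Z i)]))%E)
  (* (omega(x))_{x >= 0} identically distributed *)
  (omega_ident : forall (x M : nat) (B : nat -> set R),
      (forall i, measurable (B i)) ->
      P (\bigcap_(i in [set i | (i < M)%N]) [set t | B i (omega t x%:Z i)]) =
      P (\bigcap_(i in [set i | (i < M)%N]) [set t | B i (omega t 0%R i)]))
  (only_two : {ae P, forall t, forall i : nat, (3 <= i)%N -> omega t 0%R i = 2^-1%R})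
  (second_nontriv : (P [set t | omega t 0%R 2%N = 2^-1%R] < 1)%E) :
  Rintegral P setT (fun t => quenched_pos_forever (omega t)) =
  Rintegral P setT (fun t => omega t 0%R 1%N) *
  Num.max (fine (\int[P]_t delta0 (omega t))%E - 1) 0 /
  Rintegral P setT (fun t => (2 * omega t 0%R 2%N - 1) * omega t 0%R 1%N).
Proof.
rewrite (expect_quenched_pos_forever omega_meas omega_range omega_indep omega_ident).
rewrite (expect_stay omega_meas omega_range omega_indep omega_ident only_two
  second_nontriv).
by rewrite mulrA.
Qed.
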